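(* Let $r\ge 2$ and $1\le i\le r$ be integers, $q$ complex with $|q|<1$, and $z$ a nonzero complex number such that no denominator below vanishes. Then \begin{align*} \sum_{k\in\Lambda^{r-1}}\frac{(-q^{1-2k_1}/z;q^2)_{k_1}\,q^{2\sum_{j=1}^{r-1}k_j^2+2\sum_{j=i}^{r-1}k_j}}{(zq^2;q^2)_{k_{r-1}}\prod_{j=1}^{r-2}(q^2;q^2)_{k_j-k_{j+1}}}z^{2\sum_{j=1}^{r-1}k_j} ={}&\frac{(-zq,1/z;q^2)_\infty}{(z^2q^2,1/z^2;q^2)_\infty}(q^{4r};q^{4r})_\infty\\ &\times\Big[(z^{2r}q^{4r+1-2i},z^{-2r}q^{2i-1};q^{4r})_\infty+z^{2i-1-2r}(z^{2r}q^{2i-1},z^{-2r}q^{4r+1-2i};q^{4r})_\infty\Big]. \end{align*}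
   Context: For complex $x$ and $k\in\mathbb Z\cup\{\infty\}$ the $q$-shifted factorial is $(x;q)_0=1$, $(x;q)_k=\prod_{j=1}^k(1-xq^{j-1})$ for $k>0$ (including $k=\infty$), and $(x;q)_k=\prod_{j=1}^{-k}(1-xq^{-j})^{-1}$ for $k<0$; $(x_1,\dots,x_m;q)_k=\prod_l(x_l;q)_k$. For $r\ge2$, $k=(k_1,\dots,k_{r-1})$ and $\Lambda^{r-1}=\{k\in\mathbb Z^{r-1}:\infty>k_1\ge\dots\ge k_{r-1}>-\infty\}$. Empty products are $1$, empty sums $0$. *)

(* Defs.v *)
From HB Require Import structures.
From mathcomp Require Import all_boot all_order all_algebra finmap.
From mathcomp Require Import all_classical all_reals topology normedtype.
From mathcomp Require Import summability.
From mathcomp Require Export complex.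

Set Implicit Arguments.
Unset Strict Implicit.
Unset Printing Implicit Defensive.

Import Order.TTheory GRing.Theory Num.Theory.
Import numFieldNormedType.Exports.

Local Open Scope classical_set_scope.
Local Open Scope ring_scope.

Definition qpoch (F : fieldType) (x q : F) (k : int) : F :=
  match k with
  | Posz n => \prod_(1 <= j < n.+1) (1 - x * q ^+ j.-1)
  | Negz n => \prod_(1 <= j < n.+2) (1 - x * q ^- j)^-1
  end.

(* For k < 0, (x; q)_k is a product of reciprocals; since 0^-1 = 0 here, that
   these reciprocals exist has to be said separately.  Vacuous for k >= 0. *)
Definition qpoch_wd (F : fieldType) (x q : F) (k : int) : Prop :=
  forall j : nat, (0 < j)%N -> j%:Z <= - k -> 1 - x * q ^- j != 0.

Definition qpoch_inf (K : numFieldType) (x q : K) : K :=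
  lim ((fun n : nat => \prod_(1 <= j < n.+1) (1 - x * q ^+ j.-1)) @ \oo).

Definition qpoch_inf2 (K : numFieldType) (x y q : K) : K :=
  qpoch_inf x q * qpoch_inf y q.

(* Nonincreasing n-tuples of integers, of either sign. *)
Definition Lambda (n : nat) : choiceType :=
  {k : n.-tuple int | sorted >=%R k}.

(* The components are numbered from 1: k_1 >= ... >= k_n. *)
Definition part (n : nat) (k : Lambda n) (j : nat) : int :=
  nth 0 (val k : n.-tuple int) j.-1.

(* Unconditional summation: the finite partial sums converge to s along the
   finite subsets of I directed by inclusion. *)
Definition has_sum (I : choiceType) (K : numFieldType) (f : I -> K) (s : K)
  : Prop := partial_sum f @ totally --> s.

(* Main.v *)
Require Import Defs.
From mathcomp Require Import all_boot all_order all_algebra finmap.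
From mathcomp Require Import all_classical all_reals topology normedtype.
From mathcomp Require Import summability sequences exp.
From mathcomp Require Import zify ring lra.

(** With Q = q^2, write k_N(n) = 1 / ((Q; Q)_(N-n) (z^2 Q; Q)_(N+n)), which
    vanishes for n > N, and call (alpha, beta) a bilateral Bailey pair when
    beta_N = sum_n alpha_n k_N(n) for every integer N.

    - The innermost factor beta_N = 1 / (zQ; Q)_N belongs to such a pair, with
      alpha_n proportional to (-1)^n z^(3n) q^(3n^2-n) (1 + z Q^n): both sides
      satisfy the same first order recurrence in N, and the constant is read off
      as N -> -oo, where the term n = N dominates.
    - Summing beta_s against z^(2s) Q^(s^2) / (Q; Q)_(N-s) multiplies alpha_n by
      z^(2n) Q^(n^2).  This consumes one index k_j.
    - If alpha_n = g_n - z^2 Q^(2n-1) g_(n-1), then Q^s beta_s belongs to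
      Q^n g_n - Q^(n-1) g_(n-1).  This accounts for the linear exponents, j >= i.
    - The outermost weight W_s, coming from k_1, satisfies
      sum_s W_s k_s(n) = (-zq; Q)_oo / (z^2 Q; Q)_oo q^(n^2) z^n.

    What is left is a sum over n of two theta series, evaluated by Jacobi's
    triple product.  All sums converge absolutely thanks to Gaussian bounds
    C M^|n| |q|^(e(n)) with e quadratic, which also justify the exchanges. *)

Set Implicit Arguments.
Unset Strict Implicit.
Unset Printing Implicit Defensive.

Import Order.TTheory GRing.Theory Num.Theory.
Import numFieldNormedType.Exports.

Local Open Scope classical_set_scope.
Local Open Scope fset_scope.
Local Open Scope ring_scope.

#[local] Existing Instance totally_filter.
#[local] Existing Instance eventually_filter.

(** The initial pair and the outermost sum therefore come from first order recurrences, each proved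
    by a telescoping certificate whose total over Z is zero; the one constant left free is fixed by
    a dominated limit in the index.

    The obstacle to convergence is 1 / (z^2 Q; Q)_(N+n), which grows like |q|^(-(N+n)^2) up to
    linear exponents as N + n -> -oo. Two classes of decay compensate for it: |q|^(3n^2) for
    alpha_n, the order of the initial pair, and |q|^(s^2 + [neg2 s]) for the weights, the order of
    the outermost weight. The quadratic form that remains is positive definite.

    The shape g_n - z^2 Q^(2n-1) g_(n-1) survives a layer because z^2 Q^(2n-1) is the ratio of the
    layer weights z^(2n) Q^(n^2) at n and n - 1. So a linear exponent can be absorbed at every level
    j >= i, and the two halves of the last difference become the two theta series. *)

Section Norm.
Variable R : realType.
Implicit Types x y : R[i].

(* [`|x|] has type [R[i]]; the real-valued norm makes [lra] available. *)
Definition nrm (x : R[i]) : R := complex.Re `|x|.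

Lemma nrmE x : `|x| = (real_complex R (nrm x)).
Proof. by rewrite /nrm RRe_real // normr_real. Qed.

Lemma nrm_ge0 x : 0 <= nrm x.
Proof. by rewrite -ler0c -nrmE. Qed.

Lemma nrmM x y : nrm (x * y) = nrm x * nrm y.
Proof. by apply: (@complexI R); rewrite rmorphM /= -!nrmE normrM. Qed.

Lemma nrmN x : nrm (- x) = nrm x.
Proof. by rewrite /nrm normrN. Qed.

Lemma nrm0 : nrm 0 = 0.
Proof. by rewrite /nrm normr0. Qed.

Lemma nrm1 : nrm 1 = 1.
Proof. by rewrite /nrm normr1. Qed.

Lemma nrmD x y : nrm (x + y) <= nrm x + nrm y.
Proof. by rewrite -lecR rmorphD /= -!nrmE ler_normD. Qed.

Lemma nrmB x y : nrm (x - y) = nrm (y - x).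
Proof. by rewrite /nrm distrC. Qed.

Lemma nrm_eq0 x : (nrm x == 0) = (x == 0).
Proof.
rewrite -(normr_eq0 x) nrmE; apply/eqP/eqP => [->|] //.
by move/(@complexI R).
Qed.

Lemma nrm_gt0 x : x != 0 -> 0 < nrm x.
Proof. by move=> x0; rewrite lt_neqAle eq_sym nrm_eq0 x0 nrm_ge0. Qed.

Lemma nrmV x : nrm x^-1 = (nrm x)^-1.
Proof. by apply: (@complexI R); rewrite fmorphV /= -!nrmE normfV. Qed.

Lemma nrmX x n : nrm (x ^+ n) = nrm x ^+ n.
Proof. by elim: n => [|n IH]; rewrite ?expr0 ?nrm1 // !exprS nrmM IH. Qed.

Lemma nrmXz x (n : int) : nrm (x ^ n) = nrm x ^ n.
Proof. by case: n => n; rewrite ?NegzE -?exprnN ?nrmV -?exprnP ?nrmX. Qed.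

Lemma nrm_sum (I : Type) (r : seq I) (f : I -> R[i]) :
  nrm (\sum_(i <- r) f i) <= \sum_(i <- r) nrm (f i).
Proof.
elim: r => [|i r IH]; first by rewrite !big_nil nrm0.
by rewrite !big_cons (le_trans (nrmD _ _)) // lerD2l.
Qed.

Lemma nrmC (r : R) : nrm (real_complex R r) = `|r|.
Proof.
apply: (@complexI R); rewrite -nrmE normc_def /= expr0n addr0.
by rewrite sqrtr_sqr.
Qed.

Lemma Re_le_nrm x : `|complex.Re x| <= nrm x.
Proof. by rewrite -lecR -nrmE normc_ge_Re. Qed.

Lemma nrmi : nrm 'i%C = 1.
Proof. by rewrite /nrm normc_def /= expr0n expr1n add0r sqrtr1. Qed.

Lemma Im_le_nrm x : `|complex.Im x| <= nrm x.
Proof.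
have := Re_le_nrm (x * 'i%C); rewrite ReiNIm normrN => /le_trans; apply.
by rewrite nrmM nrmi mulr1.
Qed.

End Norm.

(** * Limits of complex-valued functions along a filter *)

Section Cv.
Variables (R : realType) (T : Type) (F : set_system T).
Context {FF : ProperFilter F}.
Implicit Types (u v : T -> R[i]) (l : R[i]).

Definition cv u l := forall e : R, 0 < e -> F (fun t => nrm (u t - l) < e).

Lemma cv_cst l : cv (fun=> l) l.
Proof. by move=> e e0; apply: filterE => t; rewrite subrr nrm0. Qed.

Lemma eq_cv u v l : (forall t, u t = v t) -> cv u l -> cv v l.
Proof. by move=> uv ul e /ul; apply: filterS => t; rewrite uv. Qed.

Lemma cvD u v l m : cv u l -> cv v m -> cv (fun t => u t + v t) (l + m).
Proof.
move=> ul vm e e0; have e20 : 0 < e / 2 by rewrite divr_gt0.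
apply: filterS2 (ul _ e20) (vm _ e20) => t h1 h2.
rewrite opprD addrACA; have := nrmD (u t - l) (v t - m); lra.
Qed.

Lemma cvZ c u l : cv u l -> cv (fun t => c * u t) (c * l).
Proof.
move=> ul e e0; have c1 : 0 < nrm c + 1 by rewrite ltr_wpDl ?nrm_ge0.
have /ul : 0 < e / (nrm c + 1) by rewrite divr_gt0.
apply: filterS => t h; rewrite -mulrBr nrmM.
apply: (@le_lt_trans _ _ ((nrm c + 1) * nrm (u t - l))).
  by rewrite ler_wpM2r ?nrm_ge0 // lerDl.
by rewrite mulrC -ltr_pdivlMr.
Qed.

Lemma cvN u l : cv u l -> cv (fun t => - u t) (- l).
Proof. by move=> /(cvZ (-1)); rewrite mulN1r; apply: eq_cv => t; rewrite mulN1r. Qed.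

Lemma cvB u v l m : cv u l -> cv v m -> cv (fun t => u t - v t) (l - m).
Proof. by move=> ul /cvN; apply: cvD. Qed.

Lemma cv_bounded u l (b : R) :
  F (fun t => nrm (u t) <= b) -> cv u l -> nrm l <= b.
Proof.
move=> ub ul; apply/ler_addgt0Pr => e /ul h.
have [t [h1 h2]] := filter_ex (filterI ub h).
by rewrite -[l](subrK (u t)) addrC (le_trans (nrmD _ _)) // lerD // nrmB ltW.
Qed.

Lemma cv_unique u l m : cv u l -> cv u m -> l = m.
Proof.
move=> ul um; apply/eqP; rewrite -subr_eq0 -nrm_eq0 eq_le nrm_ge0 andbT.
apply: (cv_bounded _ (cvB ul um)); apply: filterE => t.
by rewrite subrr nrm0.
Qed.

Lemma cvM0 u v (b : R) : (forall t, nrm (u t) <= b) -> cv v 0 ->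
  cv (fun t => u t * v t) 0.
Proof.
move=> ub v0 e e0; have b1 : 0 < `|b| + 1 by rewrite ltr_wpDl.
have /v0 : 0 < e / (`|b| + 1) by rewrite divr_gt0.
apply: filterS => t; rewrite !subr0 nrmM => h.
apply: (@le_lt_trans _ _ ((`|b| + 1) * nrm (v t))).
  rewrite ler_wpM2r ?nrm_ge0 // (le_trans (ub t)) //.
  by rewrite (le_trans (ler_norm b)) // lerDl.
by rewrite mulrC -ltr_pdivlMr.
Qed.

Lemma cvM u v l m : cv u l -> cv v m -> cv (fun t => u t * v t) (l * m).
Proof.
move=> ul vm.
have key : cv (fun t => (u t - l) * (v t - m)) 0.
  move=> e e0; have s0 : 0 < Num.sqrt e by rewrite sqrtr_gt0.
  apply: filterS2 (ul _ s0) (vm _ s0) => t h1 h2; rewrite subr0 nrmM.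
  by rewrite -[e]sqr_sqrtr ?ltW // expr2 ltr_pM ?nrm_ge0.
have := cvB (cvD (cvD key (cvZ l vm)) (cvZ m ul)) (cv_cst (l * m)).
have -> : 0 + l * m + m * l - l * m = l * m by ring.
by apply: eq_cv => t; ring.
Qed.

Lemma cv_sum (I : Type) (r : seq I) (f : I -> T -> R[i]) (g : I -> R[i]) :
  (forall i, cv (f i) (g i)) ->
  cv (fun t => \sum_(i <- r) f i t) (\sum_(i <- r) g i).
Proof.
move=> fg; elim: r => [|i r IH].
  by rewrite big_nil; apply: eq_cv (cv_cst 0) => t; rewrite big_nil.
rewrite big_cons; apply: eq_cv (cvD (fg i) IH) => t; by rewrite big_cons.
Qed.

End Cv.

Lemma dist_cvg (K : numFieldType) (T : Type) (F : set_system T)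
    (FF : Filter F) (u : T -> K) (l : K) :
  (forall e : K, 0 < e -> F (fun t => `|u t - l| < e)) -> u @ F --> l.
Proof.
move=> ul; apply/(@cvgrPdist_lt K K^o) => e /ul.
by apply: filterS => t; rewrite distrC.
Qed.

Lemma cv_dist (R : realType) (T : Type) (F : set_system T) (FF : ProperFilter F)
    (u : T -> R[i]) (l : R[i]) : cv F u l ->
  forall e : R[i], 0 < e -> F (fun t => `|u t - l| < e).
Proof.
move=> ul e e0.
have er : e = real_complex R (complex.Re e) by rewrite RRe_real // gtr0_real.
have /ul : 0 < complex.Re e by rewrite -ltcR -er.
by apply: filterS => t; rewrite er nrmE ltcR.
Qed.

Lemma cv_lim (K : numFieldType) (T : Type) (F : set_system T)
    (FF : ProperFilter F) (u : T -> K) (l : K) : u @ F --> l -> lim (u @ F) = l.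
Proof. by move=> ul; apply: (@cvg_lim K (@norm_hausdorff K K^o)). Qed.

(** * Sums over finite sets *)

Section FsetSums.

Lemma big_fsetM (V : nmodType) (I J : choiceType) (A : {fset I}) (B : {fset J})
    (f : I * J -> V) :
  \sum_(p <- A `*` B) f p = \sum_(i <- A) \sum_(j <- B) f (i, j).
Proof.
rewrite -(big_allpairs_dep (op := +%R) (h := fun (i : I) (j : J) => (i, j))
  (r1 := A) (r2 := fun=> B)).
apply: perm_big; apply: uniq_perm; first exact: fset_uniq.
- apply: allpairs_uniq; [exact: fset_uniq|exact: fset_uniq|].
  by move=> [a b] [c d] _ _ [-> ->].
- move=> [i j]; rewrite in_fsetM /=; apply/andP/allpairsP => /=.
    by case=> iA jB; exists (i, j).
  by case=> [[a b] [/= aA bB [-> ->]]].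
Qed.

Lemma big_fsetDs (V : nmodType) (I : choiceType) (A B : {fset I}) (f : I -> V) :
  A `<=` B -> \sum_(i <- B) f i = \sum_(i <- A) f i + \sum_(i <- B `\` A) f i.
Proof.
move=> AB; rewrite (big_fsetID _ (mem A) B) /=; congr (_ + _).
  rewrite (_ : [fset x in B | x \in A] = A) //.
  apply/fsetP => x; rewrite !inE /=; apply/andP/idP => [[]|xA] //.
  by rewrite (fsubsetP AB).
rewrite (_ : [fset x in B | x \notin A] = B `\` A) //.
by apply/fsetP => x; rewrite !inE /= andbC.
Qed.

Lemma ler_sum_fset (R : numDomainType) (I : choiceType) (A B : {fset I})
    (f : I -> R) : (forall i, 0 <= f i) -> A `<=` B ->
  \sum_(i <- A) f i <= \sum_(i <- B) f i.
Proof. by move=> f0 /big_fsetDs ->; rewrite lerDl sumr_ge0. Qed.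

End FsetSums.

Section Summation.
Variable R : realType.

(** * Unconditional summation *)
Definition HS (I : choiceType) (f : I -> R[i]) (s : R[i]) :=
  cv totally (fun F : {fset I} => \sum_(i <- F) f i) s.

Definition absb (I : choiceType) (b : I -> R) (B : R) :=
  forall F : {fset I}, \sum_(i <- F) b i <= B.

Definition summ (I : choiceType) (f : I -> R[i]) :=
  exists B, absb (fun i => nrm (f i)) B.

Lemma HS_has_sum (I : choiceType) (f : I -> R[i]) s : HS f s -> has_sum f s.
Proof.
move=> fs; apply: (@dist_cvg _ _ _ (@totally_filter I)).
apply: (@cv_dist _ _ _ (@totally_filter I)).
by apply: eq_cv fs => F; rewrite /partial_sum big_seq_fsetE.
Qed.

Section OneIndex.
Variable I : choiceType.
Implicit Types (f g : I -> R[i]) (s t : R[i]).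

Lemma eq_HS f g s : (forall i, f i = g i) -> HS f s -> HS g s.
Proof. by move=> fg; apply: eq_cv => F; apply: eq_bigr. Qed.

Lemma HSD f g s t : HS f s -> HS g t -> HS (fun i => f i + g i) (s + t).
Proof. by move=> fs gt; apply: eq_cv (cvD fs gt) => F; rewrite big_split. Qed.

Lemma HSZ c f s : HS f s -> HS (fun i => c * f i) (c * s).
Proof. by move=> fs; apply: eq_cv (cvZ c fs) => F; rewrite mulr_sumr. Qed.

Lemma HSB f g s t : HS f s -> HS g t -> HS (fun i => f i - g i) (s - t).
Proof. by move=> fs gt; apply: eq_cv (cvB fs gt) => F; rewrite sumrB. Qed.

Lemma HS_unique f s t : HS f s -> HS f t -> s = t.
Proof. exact: cv_unique. Qed.

Lemma absb_ge0 (b : I -> R) B : absb b B -> 0 <= B.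
Proof. by move/(_ fset0); rewrite big_seq_fset0. Qed.

Lemma absb_le (b b' : I -> R) B :
  (forall i, b i <= b' i) -> absb b' B -> absb b B.
Proof. by move=> bb h F; apply: le_trans (h F); apply: ler_sum. Qed.

Lemma absbZ c (b : I -> R) B : 0 <= c -> absb b B ->
  absb (fun i => c * b i) (c * B).
Proof. by move=> c0 h F; rewrite -mulr_sumr ler_wpM2l. Qed.

Lemma HS_ge0 (b : I -> R) B : (forall i, 0 <= b i) -> absb b B ->
  exists s, HS (fun i => real_complex R (b i)) s.
Proof.
move=> b0 hB; pose E : set R := [set x | exists F : {fset I}, x = \sum_(i <- F) b i].
have supE : has_sup E.
  split; first by exists (\sum_(i <- fset0) b i), fset0.
  by exists B => x [F ->].
exists (real_complex R (sup E)) => e e0.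
have [x [A ->] hA] := sup_adherent e0 supE.
exists A => // F AF /=; rewrite -rmorph_sum -rmorphB /= nrmC.
have h1 : \sum_(i <- F) b i <= sup E by apply: ub_le_sup; [case: supE|exists F].
have h2 := ler_sum_fset b0 AF.
rewrite ler0_norm ?subr_le0 //; lra.
Qed.

(* [Re f = (nrm f + Re f) - nrm f] is a difference of nonnegative families. *)
Lemma summ_HS f : summ f -> exists s, HS f s.
Proof.
case=> B hB.
have h (g : R[i] -> R) : (forall x, `|g x| <= nrm x) ->
    exists s, HS (fun i => real_complex R (g (f i))) s.
  move=> gn.
  have [s hs] := HS_ge0 (fun i => nrm_ge0 (f i)) hB.
  have [i|F|t ht] := @HS_ge0 (fun i => nrm (f i) + g (f i)) (B + B).
  - have := gn (f i); rewrite ler_norml => /andP[]; lra.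
  - rewrite big_split lerD //; apply: (absb_le _ hB) => i.
    by rewrite (le_trans (ler_norm _)).
  exists (t - s); apply: eq_HS (HSB ht hs) => i.
  by rewrite -rmorphB /= addrC addKr.
have [s hs] := h _ (@Re_le_nrm R); have [t ht] := h _ (@Im_le_nrm R).
exists (s + 'i%C * t); apply: eq_HS (HSD hs (HSZ 'i%C ht)) => i.
by rewrite -complexE.
Qed.

Lemma summ_le f g : (forall i, nrm (f i) <= nrm (g i)) -> summ g -> summ f.
Proof. by move=> fg [B hB]; exists B; apply: absb_le hB. Qed.

Lemma summZ c f : summ f -> summ (fun i => c * f i).
Proof.
case=> B /(absbZ (nrm_ge0 c)) h; exists (nrm c * B); apply: absb_le h => i.
by rewrite nrmM.
Qed.

(** The finite set [A] is chosen from the dominating family [b] alone, before [f], so that one [A]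
    serves a whole sequence of families at once. *)
Lemma HS_tail (b : I -> R) B (e : R) : (forall i, 0 <= b i) -> absb b B ->
  0 < e -> exists A : {fset I}, forall (f : I -> R[i]) s,
    (forall i, nrm (f i) <= b i) -> HS f s ->
    nrm (s - \sum_(i <- A) f i) <= e.
Proof.
move=> b0 hB e0; have [t ht] := HS_ge0 b0 hB.
have e20 : 0 < e / 2 by rewrite divr_gt0.
have [A _ hA] := ht _ e20.
exists A => f s fb fs.
apply: (cv_bounded (F := totally)
  (u := fun F : {fset I} => \sum_(i <- F) f i - \sum_(i <- A) f i));
  last by apply: cvB fs (cv_cst _).
exists A => // F AF /=.
rewrite (big_fsetDs f AF) addrC addKr (le_trans (nrm_sum _ _)) //.
apply: (@le_trans _ _ (\sum_(i <- F `\` A) b i)); first exact: ler_sum.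
have := hA F AF; have := hA A (fsubset_refl A); rewrite /=.
rewrite -!rmorph_sum /=.
set x := real_complex R _ - t; set y := real_complex R _ - t => h1 h2.
have h3 := nrmD y (- x); rewrite nrmN in h3.
have h4 : y - x = real_complex R (\sum_(i <- F `\` A) b i).
  by rewrite /x /y (big_fsetDs b AF) rmorphD /=; ring.
move: h3; rewrite h4 nrmC ger0_norm ?sumr_ge0 //; lra.
Qed.

(** Dominated convergence for series: [HS_tail] cuts off the sums [s n] and the limit [t] outside
    one common finite set, on which the limit is taken termwise. *)
Lemma tannery (b : I -> R) B (f : nat -> I -> R[i]) (g : I -> R[i])
    (s : nat -> R[i]) t :
  absb b B -> (forall n i, nrm (f n i) <= b i) ->
  (forall i, cv \oo (fun n => f n i) (g i)) ->
  (forall n, HS (f n) (s n)) -> HS g t -> cv \oo s t.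
Proof.
move=> hB fb fg fs gt e e0.
have b0 i : 0 <= b i by apply: le_trans (fb 0%N i); exact: nrm_ge0.
have gb i : nrm (g i) <= b i.
  by apply: (cv_bounded _ (fg i)); apply: filterE => n.
have e40 : 0 < e / 4 by rewrite divr_gt0.
have [A hA] := HS_tail b0 hB e40.
have /(_ _ e40) := cv_sum (FF := eventually_filter) A fg; apply: filterS => n h.
have h1 := hA _ _ (fb n) (fs n); have h2 := hA _ _ gb gt.
rewrite nrmB in h2.
set x := \sum_(i <- A) f n i in h h1; set y := \sum_(i <- A) g i in h h2.
have -> : s n - t = (s n - x) + (x - y) + (y - t) by ring.
have := nrmD (s n - x + (x - y)) (y - t); have := nrmD (s n - x) (x - y).
by clearbody x y; lra.
Qed.

End OneIndex.

Section TwoIndices.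
Variables I J : choiceType.

(** [h'] is a partial inverse of the injection [h]; where it returns [None] the terms vanish. This
    serves to pass from all tuples to the nonincreasing ones. *)
Lemma HS_reindex (h : I -> J) (h' : J -> option I) (f : J -> R[i]) s :
  pcancel h h' -> ocancel h' h -> (forall j, h' j = None -> f j = 0) ->
  HS f s -> HS (fun i => f (h i)) s.
Proof.
move=> hK h'K f0 fs e e0; have [A _ hA] := fs _ e0.
exists [fset i in pmap h' A] => // F AF /=.
have inj : injective h by apply: pcan_inj hK.
pose G := [fset h i | i in F].
have -> : \sum_(i <- F) f (h i) = \sum_(j <- G) f j.
  by rewrite big_imfset //= => x y _ _ /inj.
have -> : \sum_(j <- G) f j = \sum_(j <- G `|` A) f j.
  apply: big_fset_incl; first exact: fsubsetUl.
  move=> j; rewrite in_fsetU => /orP[->//|jA] jG.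
  case hj : (h' j) => [i|]; last exact: f0.
  case/negP: jG; have hij : h i = j by have := h'K j; rewrite hj.
  apply/imfsetP; exists i => //=; apply: (fsubsetP AF).
  by rewrite in_fset /= mem_pmap; apply/mapP; exists j.
by apply: hA; apply: fsubsetUr.
Qed.

Lemma HS_reindex_bij (h : I -> J) (h' : J -> I) (f : J -> R[i]) s :
  cancel h h' -> cancel h' h -> HS f s -> HS (fun i => f (h i)) s.
Proof.
move=> hK h'K; apply: (@HS_reindex h (fun j => Some (h' j))) => //.
by move=> i; rewrite hK.
Qed.

(** If a finite set [P] witnesses the estimate for [s] and [A] contains its first projections, then
    the product of [A] with any large [B] contains [P]; the estimate survives the limit in [B]. *)
Lemma HS_fubini (f : I * J -> R[i]) (g : I -> R[i]) s : HS f s ->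
  (forall i, HS (fun j => f (i, j)) (g i)) -> HS g s.
Proof.
move=> fs fg e e0; have e20 : 0 < e / 2 by rewrite divr_gt0.
have [P _ hP] := fs _ e20.
exists [fset p.1 | p in P] => // A AP /=.
apply: (@le_lt_trans _ _ (e / 2)); last by lra.
apply: (cv_bounded (F := totally) (u := fun B : {fset J} =>
   \sum_(i <- A) \sum_(j <- B) f (i, j) - s)); last first.
  by apply: cvB (cv_cst _); apply: cv_sum.
exists [fset p.2 | p in P] => // B BP /=.
rewrite -big_fsetM; apply: ltW; apply: hP.
apply/fsubsetP => -[i j] ijP; rewrite in_fsetM /=; apply/andP; split.
  by apply: (fsubsetP AP); apply/imfsetP; exists (i, j).
by apply: (fsubsetP BP); apply/imfsetP; exists (i, j).
Qed.

Lemma absb_prod (f : I * J -> R) (b : I -> R) B : (forall p, 0 <= f p) ->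
  (forall i, absb (fun j => f (i, j)) (b i)) -> absb b B -> absb f B.
Proof.
move=> f0 fb bB P.
pose A := [fset p.1 | p in P]; pose D := [fset p.2 | p in P].
apply: (@le_trans _ _ (\sum_(p <- A `*` D) f p)).
  apply: ler_sum_fset => //; apply/fsubsetP => -[i j] ijP.
  by rewrite in_fsetM /=; apply/andP; split; apply/imfsetP; exists (i, j).
rewrite big_fsetM; apply: le_trans (bB A).
by apply: ler_sum => i _; apply: fb.
Qed.

Lemma absb_slice (f : I * J -> R) B i :
  absb f B -> absb (fun j => f (i, j)) B.
Proof.
move=> fB F; apply: le_trans (fB [fset (i, j) | j in F]).
by rewrite big_imfset //= => x y _ _ [].
Qed.

End TwoIndices.

Lemma summ_swap (I J : choiceType) (f : I * J -> R[i]) :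
  summ f -> summ (fun p : J * I => f (p.2, p.1)).
Proof.
case=> B h; exists B => F.
apply: le_trans (h [fset (p.2, p.1) | p in F]).
by rewrite big_imfset //= => -[a b] [c d] _ _ [-> ->].
Qed.

Lemma HS_exchange (I J : choiceType) (f : I -> J -> R[i]) g h :
  summ (fun p => f p.1 p.2) ->
  (forall i, HS (f i) (g i)) -> (forall j, HS (fun i => f i j) (h j)) ->
  exists s, HS g s /\ HS h s.
Proof.
move=> sf fg fh; have [s hs] := summ_HS sf; exists s; split.
  exact: HS_fubini hs fg.
apply: (HS_fubini (f := fun p : J * I => f p.2 p.1)) fh.
apply: (HS_reindex_bij (h := fun p => (p.2, p.1)) (h' := fun p => (p.2, p.1)) _ _ hs).
- by case.
- by case.
Qed.

End Summation.

(** * Geometric series on the naturals and the integers *)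

Section Geometric.
Variable R : realType.

Lemma geometric_le (p : R) n : 0 <= p < 1 -> \sum_(i < n) p ^+ i <= (1 - p)^-1.
Proof.
move=> /andP[p0 p1]; rewrite -[leRHS]mul1r ler_pdivlMr ?subr_gt0 //.
have := subrX1 p n => h.
have -> : (\sum_(i < n) p ^+ i) * (1 - p) = 1 - p ^+ n.
  by rewrite mulrC -opprB mulNr -h opprB.
by rewrite lerBlDr lerDl exprn_ge0.
Qed.

Lemma fset_nat_sub (F : {fset nat}) :
  exists n, forall m, (n <= m)%N -> F `<=` [fset i in iota 0 m].
Proof.
exists (\max_(i <- F) i.+1)%N => m hm; apply/fsubsetP => i iF.
rewrite in_fset /= mem_iota /= add0n; apply: leq_trans hm.
by rewrite (big_rem i) //= leq_maxl.
Qed.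

Lemma big_fset_iota (V : nmodType) (f : nat -> V) n :
  \sum_(i <- [fset i in iota 0 n]) f i = \sum_(i < n) f i.
Proof.
rewrite -(big_mkord xpredT) /index_iota subn0; apply: perm_big.
apply: uniq_perm; [exact: fset_uniq|exact: iota_uniq|].
by move=> i; rewrite in_fset.
Qed.

Lemma absb_geometric (p : R) : 0 <= p < 1 ->
  absb (fun i : nat => p ^+ i) (1 - p)^-1.
Proof.
move=> hp F; have [n /(_ n (leqnn _)) hn] := fset_nat_sub F.
apply: le_trans (geometric_le n hp); rewrite -big_fset_iota.
by apply: ler_sum_fset hn => i; rewrite exprn_ge0 //; case/andP: hp.
Qed.

Lemma absb_inj (I J : choiceType) (h : I -> J) (b : J -> R) B :
  injective h -> absb b B -> absb (fun i => b (h i)) B.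
Proof.
move=> inj bB F; apply: le_trans (bB [fset h i | i in F]).
by rewrite big_imfset //= => x y _ _ /inj.
Qed.

Lemma absb_geometric_int (p : R) : 0 <= p < 1 ->
  absb (fun i : int => p ^+ absz i) (2 * (1 - p)^-1).
Proof.
move=> hp; have /andP[p0 p1] := hp.
(* Sign and absolute value embed the integers into two copies of the naturals, whence the factor
   2. *)
have inj : injective (fun i : int => (i < 0, absz i)).
  by move=> [a|a] [b|b] //= [] => [->|->].
apply: (absb_inj (b := fun x : bool * nat => p ^+ x.2) inj).
apply: (absb_prod (b := fun=> (1 - p)^-1)) => [x|b|F].
- by rewrite exprn_ge0.
- exact: absb_geometric.
have i0 : 0 <= (1 - p)^-1 by rewrite invr_ge0 subr_ge0 ltW.
apply: (@le_trans _ _ (\sum_(i <- [fset true; false]) (1 - p)^-1)).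
  by apply: ler_sum_fset => //; apply/fsubsetP => -[]; rewrite !inE.
by rewrite big_fsetU1 ?inE //= big_seq_fset1 mulr_natl mulr2n.
Qed.

Lemma HS_nat (f : nat -> R[i]) s : HS f s ->
  cv \oo (fun n => \sum_(i < n) f i) s.
Proof.
move=> fs e /fs [A _ hA]; have [n hn] := fset_nat_sub A.
exists n => // m nm /=; rewrite -big_fset_iota.
by apply: hA; apply: hn.
Qed.

(** [p ^+ m] is the difference of two consecutive partial sums of the convergent geometric
    series. *)
Lemma exists_pow_lt (p e : R) : 0 <= p < 1 -> 0 < e ->
  exists n : nat, forall m, (n <= m)%N -> p ^+ m < e.
Proof.
move=> hp e0; have /andP[p0 p1] := hp.
have [s /HS_nat hs] := HS_ge0 (fun i => exprn_ge0 i p0) (absb_geometric hp).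
have e20 : 0 < e / 2 by rewrite divr_gt0.
have [n _ hn] := hs _ e20; exists n => m nm.
have h1 := hn m nm; have h2 := hn m.+1 (leqW nm); move: h1 h2; rewrite /=.
rewrite big_ord_recr /= -rmorph_sum /=.
set y := real_complex R _; set x := real_complex R _ => h1 h2.
have h3 := nrmD (x + y - s) (- (x - s)); rewrite nrmN in h3.
have h4 : x + y - s - (x - s) = y by ring.
rewrite h4 nrmC ger0_norm ?exprn_ge0 // in h3; lra.
Qed.

Lemma cv_pow (x : R[i]) : nrm x < 1 -> cv \oo (fun n => x ^+ n) 0.
Proof.
move=> x1 e e0; have [|n hn] := exists_pow_lt (p := nrm x) _ e0.
  by rewrite nrm_ge0.
by exists n => // m /hn; rewrite /= subr0 nrmX.
Qed.

End Geometric.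

(** * Infinite q-products: bounds, limits, reciprocals *)

Section Products.
Variable R : realType.
Implicit Types x Q : R[i].

(** By [1 + x <= expR x], the product is at most the exponential of a geometric series. *)
Lemma prod_bounded (f : nat -> R[i]) (c p : R) : 0 <= p < 1 -> 0 <= c ->
  (forall j, nrm (f j) <= 1 + c * p ^+ j) ->
  exists C : R, forall n, nrm (\prod_(j < n) f j) <= C.
Proof.
move=> hp c0 fb; exists (expR (c * (1 - p)^-1)) => n.
have h : nrm (\prod_(j < n) f j) <= expR (\sum_(j < n) c * p ^+ j).
  elim: n => [|n IH]; first by rewrite !big_ord0 nrm1 expR0.
  rewrite !big_ord_recr /= nrmM expRD ler_pM ?nrm_ge0 //.
  by rewrite (le_trans (fb n)) // expR_ge1Dx.
rewrite (le_trans h) // ler_expR -mulr_sumr ler_wpM2l //.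
exact: geometric_le.
Qed.

Lemma qpochE x Q (n : nat) : qpoch x Q n = \prod_(j < n) (1 - x * Q ^+ j).
Proof. by rewrite /qpoch big_add1 /= big_mkord. Qed.

Lemma qpoch_bounded x Q : nrm Q < 1 ->
  exists C : R, forall n : nat, nrm (qpoch x Q n) <= C.
Proof.
move=> Q1; have [||j|C h] := @prod_bounded (fun j => 1 - x * Q ^+ j) (nrm x) (nrm Q).
- by rewrite nrm_ge0.
- exact: nrm_ge0.
- by rewrite (le_trans (nrmD _ _)) // nrm1 nrmN nrmM nrmX.
by exists C => n; rewrite qpochE.
Qed.

(** If t = |x Q^j| <= 1/2 then 1 / (1 - t) <= 1 + 2t, which settles all large [j]; the finitely many
    others are absorbed by enlarging [c]. *)
Lemma inv_factor_bounded x Q : nrm Q < 1 -> (forall j, 1 - x * Q ^+ j != 0) ->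
  exists c : R, 0 <= c /\
    forall j, nrm (1 - x * Q ^+ j)^-1 <= 1 + c * nrm Q ^+ j.
Proof.
move=> Q1 ne0.
have hQ : 0 <= nrm Q < 1 by rewrite nrm_ge0.
have x1 : 0 < nrm x + 1 by rewrite ltr_wpDl ?nrm_ge0.
have e0 : 0 < (2 * (nrm x + 1))^-1 by rewrite invr_gt0 mulr_gt0.
have [n hn] := exists_pow_lt hQ e0.
have small j : (n <= j)%N ->
    nrm (1 - x * Q ^+ j)^-1 <= 1 + (2 * nrm x) * nrm Q ^+ j.
  move=> /hn h; set t := nrm x * nrm Q ^+ j.
  have t0 : 0 <= t by rewrite mulr_ge0 ?exprn_ge0 ?nrm_ge0.
  have t2 : t <= 1 / 2.
    apply: (@le_trans _ _ ((nrm x + 1) * (2 * (nrm x + 1))^-1)).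
      by rewrite ler_pM ?nrm_ge0 ?exprn_ge0 ?nrm_ge0 ?lerDl // ltW.
    by rewrite invfM mulrCA mulfV ?gt_eqF // mulr1 mul1r.
  have h1 : 1 - t <= nrm (1 - x * Q ^+ j).
    have := nrmD (1 - x * Q ^+ j) (x * Q ^+ j).
    rewrite subrK nrm1 nrmM nrmX -/t; lra.
  rewrite nrmV -mulrA -/t invf_ple ?posrE; first last.
  - lra.
  - by apply: lt_le_trans h1; lra.
  apply: le_trans h1.
  have p1 : 0 < 1 + 2 * t by lra.
  rewrite -[leLHS]mul1r ler_pdivrMr //; nra.

have [c [c0 hc]] : exists c : R, 0 <= c /\
    forall j, (j < n)%N -> nrm (1 - x * Q ^+ j)^-1 <= 1 + c * nrm Q ^+ j.
  (* For [Q = 0] only the factor [j = 0] can differ from 1, and [0 ^+ 0 = 1] lets [c] pay for it.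
     Otherwise one may divide by [nrm Q ^+ n]. *)
  have [->|Q0] := eqVneq Q 0.
    exists (nrm (1 - x)^-1); split=> [|j _]; first exact: nrm_ge0.
    case: j => [|j]; first by rewrite !expr0 !mulr1 lerDr.
    by rewrite !expr0n /= mulr0 subr0 invr1 nrm1 nrm0 expr0n mulr0 addr0.
  elim: n {hn small} => [|n [c [c0 hc]]]; first by exists 0.
  have Qn : 0 < nrm Q ^+ n by rewrite exprn_gt0 ?nrm_gt0.
  exists (c + nrm (1 - x * Q ^+ n)^-1 / nrm Q ^+ n); split.
    by rewrite addr_ge0 ?divr_ge0 ?nrm_ge0 // ltW.
  move=> j; rewrite ltnS leq_eqVlt => /orP[/eqP ->|jn].
    rewrite mulrDl divfK ?gt_eqF //.
    by have : 0 <= c * nrm Q ^+ n by [rewrite mulr_ge0 // ltW]; lra.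
  apply: le_trans (hc j jn) _; rewrite lerD2l ler_wpM2r ?exprn_ge0 ?nrm_ge0 //.
  by rewrite lerDl divr_ge0 ?nrm_ge0 // ltW.
exists (c + 2 * nrm x); split; first by rewrite addr_ge0 ?mulr_ge0 ?nrm_ge0.
move=> j; have Qj : 0 <= nrm Q ^+ j by rewrite exprn_ge0 ?nrm_ge0.
have xj := mulr_ge0 (nrm_ge0 x) Qj; have cj := mulr_ge0 c0 Qj.
by have [/small|/hc] := leqP n j; lra.
Qed.

Lemma qpochV_bounded x Q : nrm Q < 1 -> (forall j, 1 - x * Q ^+ j != 0) ->
  exists C : R, forall n : nat, nrm (qpoch x Q n)^-1 <= C.
Proof.
move=> Q1 /(inv_factor_bounded Q1) [c [c0 hc]].
have [|C h] := prod_bounded (p := nrm Q) _ c0 hc; first by rewrite nrm_ge0.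
by exists C => n; rewrite qpochE -prodfV.
Qed.

(** Consecutive differences of (x; Q)_n are -(x; Q)_n x Q^n, geometrically small since the products
    are bounded, so their series converges. Hence the [lim] in [qpoch_inf] is a genuine limit and
    not a default value. *)
Lemma qpoch_inf_cv x Q : nrm Q < 1 ->
  cv \oo (fun n : nat => qpoch x Q n) (qpoch_inf x Q).
Proof.
move=> Q1; have hQ : 0 <= nrm Q < 1 by rewrite nrm_ge0.
have [C hC] := qpoch_bounded x Q1.
pose d n := qpoch x Q n.+1 - qpoch x Q n.
have dE n : d n = - qpoch x Q n * (x * Q ^+ n).
  by rewrite /d !qpochE big_ord_recr /=; ring.
have [|s /HS_nat hs] := @summ_HS R _ d.
  have C0 : 0 <= C by apply: le_trans (hC 0%N); exact: nrm_ge0.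
  have Cx : 0 <= C * nrm x by rewrite mulr_ge0 ?nrm_ge0.
  exists (C * nrm x * (1 - nrm Q)^-1).
  apply: absb_le (absbZ Cx (absb_geometric hQ)) => n.
  rewrite dE !nrmM nrmN nrmX mulrA ler_wpM2r ?exprn_ge0 ?nrm_ge0 //.
  by rewrite ler_wpM2r ?nrm_ge0.
have h : cv \oo (fun n : nat => qpoch x Q n) (s + 1).
  apply: eq_cv (cvD hs (cv_cst 1)) => n.
  rewrite -(big_mkord xpredT d) telescope_sumr //.
  by rewrite {2}/qpoch big_geq // subrK.
rewrite (_ : qpoch_inf x Q = s + 1) //.
by apply: cv_lim; apply: dist_cvg; apply: cv_dist.
Qed.

(** A single zero factor makes all later finite products vanish. This turns the nonvanishing of an
    infinite product in a denominator into that of each of its factors. *)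
Lemma qpoch_inf_factor x Q (j : nat) : nrm Q < 1 -> qpoch_inf x Q != 0 ->
  1 - x * Q ^+ j != 0.
Proof.
move=> Q1; apply: contra_neq => h.
apply: (cv_unique (qpoch_inf_cv x Q1)) => e e0.
exists j.+1 => // n jn; change (nrm (qpoch x Q n%:Z - 0) < e).
by rewrite qpochE (bigD1 (Ordinal jn)) //= h mul0r subr0 nrm0.
Qed.

(** Bounded reciprocals keep [u n], and hence the limit, away from 0. Then 1/u - 1/l = (1/u) ((l -
    u)/l) is a bounded sequence times a null sequence. *)
Lemma cvV (u : nat -> R[i]) l (C : R) : (forall n, u n != 0) ->
  (forall n, nrm (u n)^-1 <= C) -> cv \oo u l ->
  l != 0 /\ cv \oo (fun n => (u n)^-1) l^-1.
Proof.
move=> u0 uC ul.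
have C0 : 0 < C by apply: lt_le_trans (uC 0%N); rewrite nrm_gt0 ?invr_eq0.
have l0 : l != 0.
  apply/eqP => l0; have /ul [n _ /(_ n (leqnn _))] : 0 < C^-1 by rewrite invr_gt0.
  rewrite /= l0 subr0 => h; have := uC n; rewrite nrmV => h2.
  have un := nrm_gt0 (u0 n).
  move: h2; rewrite leNgt => /negP; apply.
  by rewrite -[C]invrK ltf_pV2 ?posrE ?invr_gt0.
split=> //.
have h0 : cv \oo (fun n => (l - u n) / l) 0.
  have h : cv \oo (fun n => l^-1 * (l - u n)) (l^-1 * (l - l)).
    by apply: cvZ; apply: cvB ul; apply: cv_cst.
  by rewrite subrr mulr0 in h; apply: eq_cv h => n; rewrite mulrC.
have h : cv \oo (fun n => (u n)^-1 * ((l - u n) / l) + l^-1) (0 + l^-1).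
  by apply: cvD (cv_cst _); apply: cvM0 uC h0.
rewrite add0r in h; apply: eq_cv h => n.
by field; rewrite l0 u0.
Qed.

Lemma qpoch_neq0 x Q (n : nat) : (forall j, 1 - x * Q ^+ j != 0) ->
  qpoch x Q n != 0.
Proof. by move=> h; rewrite qpochE; apply/prodf_neq0 => i _; apply: h. Qed.

Lemma qpochV_inf_cv x Q : nrm Q < 1 -> (forall j, 1 - x * Q ^+ j != 0) ->
  qpoch_inf x Q != 0 /\
  cv \oo (fun n : nat => (qpoch x Q n)^-1) (qpoch_inf x Q)^-1.
Proof.
move=> Q1 h; have [C hC] := qpochV_bounded Q1 h.
by apply: cvV hC (qpoch_inf_cv x Q1) => n; apply: qpoch_neq0.
Qed.

End Products.

(** * Step rules for the q-shifted factorial at indices of either sign *)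

Section Recurrences.
Variable F : fieldType.
Implicit Types x Q : F.

(** Stepping up from [n < 0] removes the reciprocal of a factor, which must then be nonzero; from
    [n >= 0] a factor is merely added. *)
Lemma qpochS x Q (n : int) : (n < 0 -> 1 - x * Q ^ n != 0) ->
  qpoch x Q (n + 1) = qpoch x Q n * (1 - x * Q ^ n).
Proof.
case: n => n h.
  by rewrite -PoszD addn1 /qpoch big_nat_recr //=.
have {}h : 1 - x * Q ^- n.+1 != 0 by apply: (h isT).
have -> : Negz n + 1 = - n%:Z by rewrite NegzE; lia.
rewrite -[Q ^ Negz n]/(Q ^- n.+1) {2}/qpoch big_nat_recr //= divfK //.
case: n {h} => [|n]; first by rewrite (_ : - 0%:Z = 0%:Z) // /qpoch !big_geq.
by rewrite -NegzE.
Qed.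

Lemma qpochVS x Q (n : int) : 1 - x * Q ^ n != 0 ->
  (qpoch x Q n)^-1 = (qpoch x Q (n + 1))^-1 * (1 - x * Q ^ n).
Proof. by move=> h; rewrite qpochS // invfM -mulrA mulVf ?mulr1. Qed.

(* [(Q; Q)_m] contains the junk factor [0^-1 = 0] for [m < 0]. *)
Lemma qpochQ_neg Q (m : int) : Q != 0 -> m < 0 -> (qpoch Q Q m)^-1 = 0.
Proof.
case: m => // m Q0 _; rewrite /qpoch big_nat_recl //= expr1 mulfV //.
by rewrite subrr invr0 mul0r invr0.
Qed.

(** Valid across zero as well: for [m < -1] both sides vanish, and at [m = -1] the factor 1 - Q^0
    annihilates the right-hand side. *)
Lemma qpochQVS Q (m : int) : Q != 0 -> (forall j : nat, 1 - Q * Q ^+ j != 0) ->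
  (qpoch Q Q m)^-1 = (qpoch Q Q (m + 1))^-1 * (1 - Q ^ (m + 1)).
Proof.
move=> Q0 h; case: (ltP m 0) => m0.
  rewrite qpochQ_neg //; have [m1|m1] := ltP (m + 1) 0.
    by rewrite qpochQ_neg // mul0r.
  have -> : m + 1 = 0 by lia.
  by rewrite expr0z subrr mulr0.
case: m m0 => // m _; rewrite expfzDr // expr1z [_ * Q]mulrC.
by apply: qpochVS; apply: h.
Qed.

End Recurrences.

Section Growth.
Variables (R : realType) (q : R[i]).
Hypotheses (q0 : q != 0) (q1 : nrm q < 1).
Local Notation rho := (nrm q).

Let rho0 : 0 < rho. Proof. exact: nrm_gt0. Qed.
Let rhoW : 0 <= rho. Proof. exact: nrm_ge0. Qed.
Let rhoV : 1 <= rho^-1. Proof. by rewrite invf_ge1 ?ltW. Qed.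
Let rhoVW : 0 <= rho^-1. Proof. by rewrite invr_ge0. Qed.

Lemma rho_le (a b : int) : b <= a -> rho ^ a <= rho ^ b.
Proof.
move=> ba; have -> : a = b + (absz (a - b))%:Z by lia.
by rewrite expfzDr ?gt_eqF // ler_piMr ?exprz_ge0 ?exprn_ile1 ?ltW.
Qed.

(** * Gaussian growth bounds *)
(* [l] collects linear and [e] quadratic exponents; [C] and [M] are uniform in
   the index, so that a bound over a product index is a domination. *)
Definition gb (I : Type) (l : I -> nat) (e : I -> int) (f : I -> R[i]) :=
  exists C M : R, [/\ 0 <= C, 1 <= M &
    forall i, nrm (f i) <= C * M ^+ l i * rho ^ e i].

Section OneType.
Variable I : Type.
Implicit Types (l : I -> nat) (e : I -> int) (f g : I -> R[i]).

Lemma eq_gb l e f g : (forall i, f i = g i) -> gb l e f -> gb l e g.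
Proof. by move=> fg [C [M [? ? h]]]; exists C, M; split=> // i; rewrite -fg. Qed.

(* Since [rho ^ - K] can be absorbed in [M], linear losses in [e] are harmless. *)
Lemma gb_weak K l e l' e' f : gb l e f ->
  (forall i, f i != 0 -> (l i <= K * l' i + K)%N /\
     e' i <= e i + K%:Z * (l' i)%:Z + K%:Z) ->
  gb l' e' f.
Proof.
move=> [C [M [C0 M1 h]]] hle; have M0 : 0 <= M by apply: le_trans M1.
exists (C * M ^+ K * rho^-1 ^+ K), (M ^+ K * rho^-1 ^+ K); split.
- by rewrite !mulr_ge0 ?exprn_ge0 ?invr_ge0.
- by rewrite mulr_ege1 // exprn_ege1.
move=> i; have [->|/hle[hl he]] := eqVneq (f i) 0.
  by rewrite nrm0 !mulr_ge0 ?exprn_ge0 ?exprz_ge0 ?mulr_ge0 ?exprn_ge0 ?invr_ge0.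
apply: le_trans (h i) _.
have -> : C * M ^+ K * rho^-1 ^+ K * (M ^+ K * rho^-1 ^+ K) ^+ l' i * rho ^ e' i
   = C * M ^+ (K * l' i + K) * rho ^ (e' i - (K%:Z * (l' i)%:Z + K%:Z)).
  rewrite exprMn -!exprM exprD expfzDr ?gt_eqF // -PoszM -PoszD -exprnN.
  rewrite -exprVn exprD; ring.
rewrite ler_pM ?mulr_ge0 ?exprn_ge0 ?exprz_ge0 //; last by apply: rho_le; lia.
by rewrite ler_wpM2l // ler_weXn2l.
Qed.

Lemma gbM l1 l2 e1 e2 f g : gb l1 e1 f -> gb l2 e2 g ->
  gb (fun i => l1 i + l2 i)%N (fun i => e1 i + e2 i) (fun i => f i * g i).
Proof.
move=> [C [M [C0 M1 h]]] [D [N [D0 N1 k]]].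
have M0 : 0 <= M by apply: le_trans M1.
have N0 : 0 <= N by apply: le_trans N1.
exists (C * D), (M * N); split; rewrite ?mulr_ge0 ?mulr_ege1 // => i.
rewrite nrmM; apply: (le_trans (ler_pM _ _ (h i) (k i))); rewrite ?nrm_ge0 //.
rewrite expfzDr ?gt_eqF //.
have -> : C * M ^+ l1 i * rho ^ e1 i * (D * N ^+ l2 i * rho ^ e2 i)
  = C * D * (M ^+ l1 i * N ^+ l2 i) * (rho ^ e1 i * rho ^ e2 i) by ring.
rewrite ler_wpM2r ?mulr_ge0 ?exprz_ge0 // ler_wpM2l ?mulr_ge0 //.
rewrite exprD ler_pM ?exprn_ge0 // lerXn2r ?nnegrE ?mulr_ge0 //.
  by rewrite ler_peMr //.
by rewrite ler_peMl //.
Qed.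

Lemma gbD l e f g : gb l e f -> gb l e g -> gb l e (fun i => f i + g i).
Proof.
move=> [C [M [C0 M1 h]]] [D [N [D0 N1 k]]].
have M0 : 0 <= M by apply: le_trans M1.
have N0 : 0 <= N by apply: le_trans N1.
exists (C + D), (M * N); split; rewrite ?addr_ge0 ?mulr_ege1 // => i.
apply: (le_trans (nrmD _ _)); rewrite mulrDl mulrDl lerD //.
  apply: le_trans (h i) _; rewrite ler_wpM2r ?exprz_ge0 // ler_wpM2l //.
  by rewrite lerXn2r ?nnegrE ?mulr_ge0 // ler_peMr //.
apply: le_trans (k i) _; rewrite ler_wpM2r ?exprz_ge0 // ler_wpM2l //.
by rewrite lerXn2r ?nnegrE ?mulr_ge0 // ler_peMl //.
Qed.

Lemma gb_bounded f (C : R) : (forall i, nrm (f i) <= C) ->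
  gb (fun=> 0%N) (fun=> 0) f.
Proof.
move=> h; exists `|C|, 1; split=> // i.
by rewrite expr0 expr0z !mulr1 (le_trans (h i)) // ler_norm.
Qed.

Lemma gb_cst (c : R[i]) : gb (fun=> 0%N) (fun=> 0) (fun _ : I => c).
Proof. exact: (@gb_bounded _ (nrm c)). Qed.

Lemma gbZ c l e f : gb l e f -> gb l e (fun i => c * f i).
Proof.
move=> h; apply: (gb_weak (K := 1%N) (gbM (gb_cst c) h)) => i _ /=.
by split; lia.
Qed.

Lemma gbN l e f : gb l e f -> gb l e (fun i => - f i).
Proof. by move/(gbZ (-1)); apply: eq_gb => i; rewrite mulN1r. Qed.

Lemma gb_powz x (n : I -> int) : x != 0 ->
  gb (fun i => absz (n i)) (fun=> 0) (fun i => x ^ n i).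
Proof.
move=> /nrm_gt0 x0; have xV : 0 < (nrm x)^-1 by rewrite invr_gt0.
exists 1, (1 + nrm x + (nrm x)^-1); split=> //; first by lra.
move=> i; rewrite expr0z mul1r mulr1 nrmXz.
case: (n i) => m /=; first by rewrite -exprnP lerXn2r ?nnegrE; lra.
by rewrite NegzE -exprnN -exprVn lerXn2r ?nnegrE; lra.
Qed.

Lemma gb_qpowz (e : I -> int) : gb (fun=> 0%N) e (fun i => q ^ e i).
Proof. by exists 1, 1; split=> // i; rewrite expr1n !mul1r nrmXz. Qed.

End OneType.

Lemma gb_comp (I J : Type) (h : J -> I) l e f : gb l e f ->
  gb (fun j => l (h j)) (fun j => e (h j)) (fun j => f (h j)).
Proof. by move=> [C [M [? ? k]]]; exists C, M. Qed.

(** M^k p^(k^2) = (M p^k)^k, and M p^k <= 1/2 as soon as [k >= n]; the constant (2M)^n covers the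
    smaller [k]. *)
Lemma gauss_geometric (M p : R) : 1 <= M -> 0 <= p < 1 ->
  exists C : R, 0 <= C /\
    forall k : nat, M ^+ k * p ^+ (k ^ 2) <= C * 2^-1 ^+ k.
Proof.
move=> M1 hp; have /andP[p0 p1] := hp.
have e0 : 0 < (2 * M)^-1 by rewrite invr_gt0; lra.
have [n hn] := exists_pow_lt hp e0.
have M21 : 1 <= (2 * M) ^+ n by rewrite exprn_ege1; lra.
exists ((2 * M) ^+ n); split=> [|k]; first by lra.
rewrite exprVn ler_pdivlMr ?exprn_gt0 //.
have -> : M ^+ k * p ^+ (k ^ 2) * 2 ^+ k = (2 * M * p ^+ k) ^+ k.
  by rewrite !exprMn -exprM -mulnn; ring.
have [/hn h|kn] := leqP n k.
  apply: le_trans M21; rewrite exprn_ile1 //.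
    by rewrite !mulr_ge0 ?exprn_ge0 //; lra.
  by rewrite -ler_pdivlMl ?mulr1 ?ltW //; lra.
apply: (@le_trans _ _ ((2 * M) ^+ k)).
  rewrite lerXn2r ?nnegrE ?mulr_ge0 ?exprn_ge0 //; try lra.
  by rewrite ler_piMr ?exprn_ile1 //; lra.
by rewrite ler_weXn2l //; [lra|exact: ltnW].
Qed.

Lemma gb_dom (I : Type) (h1 h2 : I -> int) e f :
  gb (fun i => absz (h1 i) + absz (h2 i))%N e f ->
  (forall i, f i != 0 -> h1 i ^+ 2 + h2 i ^+ 2 <= 4 * e i) ->
  exists C : R, 0 <= C /\
   forall i, nrm (f i) <= C * (2^-1 ^+ absz (h1 i) * 2^-1 ^+ absz (h2 i)).
Proof.
move=> [C [M [C0 M1 h]]] he.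
(* The fourth root of [rho] absorbs the factor 4 of the hypothesis: rho^e = p^(4e) <= p^(h1^2 +
   h2^2). *)
pose p := Num.sqrt (Num.sqrt rho).
have p0 : 0 < p by rewrite !sqrtr_gt0.
have p4 : p ^+ 4 = rho.
  by rewrite (exprM p 2 2) sqr_sqrtr ?sqrtr_ge0 // sqr_sqrtr // ltW.
have p1 : p < 1.
  rewrite -(ltr_pXn2r (n := 4)) ?nnegrE ?ltW //; by rewrite p4 expr1n.
have [|D [D0 hD]] := gauss_geometric M1 (p := p); first by rewrite ltW.
exists (C * (D * D)); split=> [|i]; first by rewrite !mulr_ge0.
have [->|fi] := eqVneq (f i) 0.
  by rewrite nrm0 !mulr_ge0 ?exprn_ge0 ?invr_ge0.
have {}he := he _ fi.
apply: le_trans (h i) _.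
have -> : C * (D * D) * (2^-1 ^+ absz (h1 i) * 2^-1 ^+ absz (h2 i))
 = C * ((D * 2^-1 ^+ absz (h1 i)) * (D * 2^-1 ^+ absz (h2 i))) by ring.
rewrite -mulrA ler_wpM2l //.
apply: le_trans (_ : (M ^+ absz (h1 i) * p ^+ (absz (h1 i) ^ 2))
  * (M ^+ absz (h2 i) * p ^+ (absz (h2 i) ^ 2)) <= _).
  rewrite exprD mulrACA ler_wpM2l ?mulr_ge0 ?exprn_ge0 //; try lra.
  have e0 : 0 <= e i.
    by rewrite -(pmulr_rge0 _ (_ : 0 < 4)) // (le_trans _ he) // addr_ge0 ?sqr_ge0.
  have -> : rho ^ e i = p ^+ (4 * absz (e i)).
    by rewrite exprM p4 -[in LHS](gez0_abs e0).
  rewrite -exprD ler_wiXn2l ?ltW //.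
  by move: he; rewrite -!mulnn; move: (h1 i) (h2 i) (e i) e0 => a b c *; nia.
have M0 : 0 <= M by apply: le_trans M1.
have pW := ltW p0.
by apply: ler_pM; rewrite ?mulr_ge0 ?exprn_ge0.
Qed.

Lemma summ_gb2 (f : int * int -> R[i]) e :
  gb (fun p => absz p.1 + absz p.2)%N e f ->
  (forall p, f p != 0 -> p.1 ^+ 2 + p.2 ^+ 2 <= 4 * e p) -> summ f.
Proof.
move=> h /(gb_dom h) [C [C0 hC]].
have h2 : 0 <= (2^-1 : R) < 1 by lra.
pose B : R := 2 * (1 - 2^-1)^-1.
exists (C * (B * B)); apply: (absb_le hC); apply: absbZ => //.
apply: (absb_prod (b := fun n => 2^-1 ^+ absz n * B)) => [p|n|].
- by rewrite mulr_ge0 ?exprn_ge0 ?invr_ge0.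
- by apply: absbZ; rewrite ?exprn_ge0 ?invr_ge0 //; apply: absb_geometric_int.
apply: absb_le (absbZ (c := B) _ (absb_geometric_int h2)) => [n|].
  by rewrite mulrC.
by rewrite /B mulr_ge0 // invr_ge0; lra.
Qed.

(** The parameter [j] lies inside the growth bound, so neither its constants nor the resulting
    family [b] depend on [j]. This is the domination that [tannery] demands. *)
Lemma dominated_gb (J : Type) (f : J -> int -> R[i]) e :
  gb (fun p => absz p.2) e (fun p => f p.1 p.2) ->
  (forall j n, f j n != 0 -> n ^+ 2 <= 4 * e (j, n)) ->
  exists (b : int -> R) B, absb b B /\ forall j n, nrm (f j n) <= b n.
Proof.
move=> h he.
have [|p|C [C0 hC]] := @gb_dom _ snd (fun=> 0) e (fun p => f p.1 p.2).
- by apply: (gb_weak (K := 1%N) h) => i _ /=; split; lia.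
- by move/he; rewrite -surjective_pairing expr0n addr0.
have h2 : 0 <= (2^-1 : R) < 1 by lra.
exists (fun n => C * 2^-1 ^+ absz n), (C * (2 * (1 - 2^-1)^-1)); split.
  by apply: absbZ => //; apply: absb_geometric_int.
by move=> j n; have := hC (j, n); rewrite /= expr0 mulr1.
Qed.

Lemma summ_gb (f : int -> R[i]) e : gb absz e f ->
  (forall n, f n != 0 -> n ^+ 2 <= 4 * e n) -> summ f.
Proof.
move=> h he.
have [|_ n /he//|b [B [hB hb]]] := @dominated_gb unit (fun _ => f) (fun p => e p.2).
  exact: (gb_comp snd h).
by exists B; apply: absb_le hB => n; apply: (hb tt).
Qed.

End Growth.

(** [neg2] measures 1 / (x; Q)_n, which is bounded for n >= 0 and of order |q|^(-n^2), up to linear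
    exponents, as n -> -oo. [pos2] measures the outer factor, which behaves the opposite way. *)
Definition neg2 (n : int) : int := if n < 0 then n ^+ 2 else 0.
Definition pos2 (n : int) : int := if n < 0 then 0 else n ^+ 2.

Lemma neg2_le s : s ^+ 2 + neg2 s <= 2 * s ^+ 2.
Proof. by rewrite /neg2 expr2; case: ifP => _; nia. Qed.

(** * Growth of the q-shifted factorials in their index *)

Section PochhammerGrowth.
Variables (R : realType) (q : R[i]).
Hypotheses (q0 : q != 0) (q1 : nrm q < 1).
Local Notation rho := (nrm q).
Local Notation Q := (q ^+ 2).

Let rho0 : 0 < rho. Proof. exact: nrm_gt0. Qed.
Let rhoW : 0 <= rho. Proof. exact: nrm_ge0. Qed.
Let rhoV : 1 <= rho^-1. Proof. by rewrite invf_ge1 ?ltW. Qed.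
Let rhoVW : 0 <= rho^-1. Proof. by rewrite invr_ge0. Qed.

Lemma Qbase_neq0 : Q != 0. Proof. by rewrite expf_neq0. Qed.

Lemma nrmQ_lt1 : nrm Q < 1.
Proof. by rewrite nrmX exprn_ilt1. Qed.

Lemma powQ_neq1 (n : nat) : 1 - Q * Q ^+ n != 0.
Proof.
rewrite -exprS subr_eq0; apply/eqP => h.
have : nrm (Q ^+ n.+1) < 1 by rewrite nrmX exprn_ilt1 ?nrm_ge0 // nrmQ_lt1.
by rewrite -h nrm1 ltxx.
Qed.

Lemma one_sub_le (x : R[i]) (m : nat) :
  nrm (1 - x * q ^- m) <= (1 + nrm x) * rho^-1 ^+ m.
Proof.
rewrite (le_trans (nrmD _ _)) // nrm1 nrmN nrmM nrmV nrmX -exprVn mulrDl mul1r.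
by rewrite lerD2r exprn_ege1.
Qed.

(** At n = -m the reciprocal is the product of 1 - x q^(-2j) for j = 1, ..., m, of order |q|^(-(2 +
    4 + ... + 2m)) = |q|^(-(m^2 + m)); the linear part goes into [M]. *)
Lemma gb_qpochV (x : R[i]) : (forall j : nat, 1 - x * Q ^+ j != 0) ->
  gb q absz (fun n => - neg2 n) (fun n => (qpoch x Q n)^-1).
Proof.
move=> h; have [C hC] := qpochV_bounded nrmQ_lt1 h.
have x0 := nrm_ge0 x.
exists (1 + `|C|), ((1 + nrm x) * rho^-1); split.
- by rewrite addr_ge0.
- by rewrite mulr_ege1 // lerDl.
have M0 m : 1 <= ((1 + nrm x) * rho^-1) ^+ m.
  by rewrite exprn_ege1 // mulr_ege1 // lerDl.
case=> [m|m].
  rewrite /neg2 /= oppr0 expr0z mulr1; apply: le_trans (hC m) _.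
  have cn := ler_norm C; apply: (@le_trans _ _ (1 + `|C|)); first by lra.
  by rewrite ler_peMr // addr_ge0.
rewrite /neg2 /=.
have -> : - (Negz m) ^+ 2 = - (m.+1 * m.+1)%N%:Z by rewrite NegzE; lia.
rewrite -exprnN -exprVn -prodfV.
have -> : \prod_(1 <= j < m.+2) ((1 - x * Q ^- j)^-1)^-1
   = \prod_(1 <= j < m.+2) (1 - x * q ^- (2 * j)).
  by apply: eq_bigr => j _; rewrite invrK exprM.
have key : forall k, nrm (\prod_(1 <= j < k.+1) (1 - x * q ^- (2 * j)))
   <= (1 + nrm x) ^+ k * rho^-1 ^+ (k * k + k).
  elim=> [|k IH]; first by rewrite big_geq // nrm1 !expr0 mulr1.
  rewrite big_nat_recr //= nrmM.
  apply: le_trans (ler_pM (nrm_ge0 _) (nrm_ge0 _) IH (one_sub_le x _)) _.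
  rewrite mulrACA -exprSr -exprD (_ : (k * k + k + 2 * k.+1)%N = (k.+1 * k.+1 +
    k.+1)%N) //.
  lia.
apply: le_trans (key m.+1) _.
have -> : (1 + nrm x) ^+ m.+1 * rho^-1 ^+ (m.+1 * m.+1 + m.+1)
   = ((1 + nrm x) * rho^-1) ^+ m.+1 * rho^-1 ^+ (m.+1 * m.+1).
  by rewrite exprD [in RHS]exprMn mulrAC mulrA.
rewrite -mulrA ler_peMl ?lerDl //.
by rewrite mulr_ge0 ?exprn_ge0 // mulr_ge0 // addr_ge0.
Qed.

Lemma gb_qpochQV : gb q (fun=> 0%N) (fun=> 0) (fun n => (qpoch Q Q n)^-1).
Proof.
have [C hC] := qpochV_bounded nrmQ_lt1 powQ_neq1.
apply: (@gb_bounded _ _ _ _ `|C|) => -[m|m].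
  by rewrite (le_trans (hC m)) // ler_norm.
by rewrite qpochQ_neg ?Qbase_neq0 // nrm0.
Qed.

Lemma gb_shift g : gb q absz (fun n => 3 * n ^+ 2) g ->
  gb q absz (fun n => 3 * n ^+ 2) (fun n => g (n - 1)).
Proof.
move=> hg; apply: (gb_weak q0 q1 (K := 10%N) (gb_comp (fun n => n - 1) hg)).
by move=> i _ /=; rewrite !expr2; split; lia.
Qed.

Lemma gb_linear c g (k : int -> int) (K : nat) : c != 0 ->
  (forall n, (absz (k n) <= K * absz n + K)%N) ->
  gb q absz (fun n => 3 * n ^+ 2) g ->
  gb q absz (fun n => 3 * n ^+ 2) (fun n => c ^ (k n) * g n).
Proof.
move=> c0 hk hg.
apply: (gb_weak q0 q1 (K := (K + 1)%N) (gbM q0 (gb_powz q k c0) hg)) => i _ /=.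
by have := hk i; split; [lia|rewrite add0r; lia].
Qed.

Section OuterFactor.
Variable z : R[i].
Hypotheses (z0 : z != 0) (hz : forall j : nat, 1 - (- q / z) * Q ^+ j != 0).

Definition outer (s : int) : R[i] := qpoch (- q ^ (1 - 2 * s) / z) Q s.

(** The argument -q^(1-2s)/z moves with [s]; reversing the product removes this dependence, since
    the [j]-th factor then involves [j] alone. A first order recurrence becomes possible. *)
Lemma outer_pos (n : nat) :
  outer n = \prod_(j < n) (1 + q ^ (- (2 * j%:Z + 1)) / z).
Proof.
rewrite /outer qpochE (reindex_inj rev_ord_inj) /=; apply: eq_bigr => j _.
have jn := ltn_ord j; rewrite -exprM.
have -> : - (2 * (j : nat)%:Z + 1) = (1 - 2 * n%:Z) + (2 * (n - j.+1))%N%:Z by lia.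
by rewrite [in RHS]expfzDr // -exprnP; ring.
Qed.

Lemma outer_neg (n : nat) : outer (- n%:Z) = (qpoch (- q / z) Q n)^-1.
Proof.
rewrite qpochE -prodfV; case: n => [|n].
  by rewrite big_ord0 (_ : - 0%:Z = 0%:Z) // outer_pos big_ord0.
rewrite -NegzE /outer /qpoch big_add1 /= big_mkord (reindex_inj rev_ord_inj) /=.
apply: eq_bigr => j _; have jn := ltn_ord j; rewrite -!exprM.
congr (1 - _)^-1.
have -> : 1 - 2 * Negz n = 1 + (2 * j)%N%:Z + (2 * (n.+1 - j.+1).+1)%N%:Z.
  by rewrite NegzE; lia.
rewrite !expfzDr // expr1z -!exprnP.
have h : q ^+ (2 * (n.+1 - j.+1).+1) != 0 by rewrite expf_neq0.
move: h; set X := q ^+ (2 * (n.+1 - j.+1).+1) => h.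
by field; rewrite z0 h.
Qed.

Lemma outerS (s : int) : outer (s + 1) = outer s * (1 + q ^ (- (2 * s + 1)) / z).
Proof.
case: s => n.
  by rewrite -PoszD addn1 !outer_pos big_ord_recr.
have -> : Negz n + 1 = - n%:Z by rewrite NegzE; lia.
rewrite NegzE !outer_neg !qpochE big_ord_recr /= invfM -mulrA.
have -> : q ^ (- (2 * - n.+1%:Z + 1)) / z = - (- q / z * Q ^+ n).
  have -> : - (2 * - n.+1%:Z + 1) = 1 + (2 * n)%N%:Z by lia.
  by rewrite expfzDr // expr1z -exprnP exprM; ring.
by rewrite mulVf ?mulr1 // hz.
Qed.

(** For s = m >= 0 the exponents 1 + 3 + ... + (2m - 1) add up to m^2; for s = -m < 0 the factor is
    the bounded 1 / (-q/z; Q)_m. *)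
Lemma gb_outer : gb q absz (fun s => - pos2 s) outer.
Proof.
have [C hC] := qpochV_bounded nrmQ_lt1 hz.
have x0 := nrm_ge0 z^-1.
exists (1 + `|C|), (1 + nrm z^-1); split; [by rewrite addr_ge0|by rewrite lerDl|].
have M0 m : 1 <= (1 + nrm z^-1) ^+ m by rewrite exprn_ege1 // lerDl.
case=> m; last first.
  have -> : outer (Negz m) = (qpoch (- q / z) Q m.+1)^-1 by rewrite NegzE outer_neg.
  rewrite /pos2 (_ : (Negz m < 0) = true) // oppr0 expr0z mulr1; apply: le_trans
    (hC _) _.
  have cn := ler_norm C; apply: (@le_trans _ _ (1 + `|C|)); first by lra.
  by rewrite ler_peMr // addr_ge0.
rewrite outer_pos /pos2 (_ : (m%:Z < 0) = false) // -[(m%:Z ^+ 2)]/((m * m)%N%:Z)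
  -exprnN -exprVn.
rewrite -mulrA; apply: (@le_trans _ _ ((1 + nrm z^-1) ^+ m * rho^-1 ^+ (m * m)));
  last first.
  by rewrite ler_peMl ?lerDl // mulr_ge0 ?exprn_ge0 // addr_ge0.
elim: m => [|m IH]; first by rewrite big_ord0 nrm1 !expr0 mulr1.
rewrite big_ord_recr /= nrmM.
have h : nrm (1 + q ^ (- (2 * m%:Z + 1)) / z) <= (1 + nrm z^-1) * rho^-1 ^+ (2 * m + 1).
  have := one_sub_le (- z^-1) (2 * m + 1); rewrite nrmN; congr (_ <= _).
  by rewrite -PoszM -PoszD -exprnN; congr nrm; ring.
apply: le_trans (ler_pM (nrm_ge0 _) (nrm_ge0 _) IH h) _.
rewrite mulrACA -exprSr -exprD (_ : (m * m + (2 * m + 1))%N = (m.+1 * m.+1)%N) //.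
lia.
Qed.

End OuterFactor.

End PochhammerGrowth.

(** * Shifts and telescoping over the integers *)

Section IntSums.
Variable R : realType.
Implicit Types f : int -> R[i].

Lemma HS_shift f s (k : int) : HS f s -> HS (fun n => f (n + k)) s.
Proof.
by apply: (HS_reindex_bij (h := fun n => n + k) (h' := fun n => n - k)) => n;
  rewrite ?addrK ?subrK.
Qed.

(** Over all of Z a summable family and its shift have the same sum, so no boundary terms occur. The
    telescoping certificates below are closed by this. *)
Lemma HS_telescope f : summ f -> HS (fun n => f (n + 1) - f n) 0.
Proof.
case/summ_HS => s hs; rewrite -(subrr s); apply: HSB => //.
exact: HS_shift.
Qed.

Lemma HS_single (I : choiceType) (f : I -> R[i]) i0 :
  (forall i, i != i0 -> f i = 0) -> HS f (f i0).
Proof.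
move=> h e e0; exists [fset i0] => // F /= sF; have iF : i0 \in F by rewrite -fsub1set.
rewrite (big_fsetD1 i0) //= big_seq big1 ?addr0 ?subrr ?nrm0 // => i.
by rewrite !inE => /andP[/h].
Qed.

End IntSums.

(** * The bilateral Bailey kernel, Bailey's transform, and the two moves on pairs *)

Section Kernel.
Variables (R : realType) (q z : R[i]).
Hypotheses (q0 : q != 0) (q1 : nrm q < 1) (z0 : z != 0).
Local Notation Q := (q ^+ 2).
Hypothesis hzz : forall n : int, 1 - z ^+ 2 * Q ^ n != 0.

Lemma QzE (n : int) : Q ^ n = q ^ (2 * n).
Proof. by rewrite exprnP exprz_exp. Qed.

Lemma QzD (m n : int) : Q ^ (m + n) = Q ^ m * Q ^ n.
Proof. by rewrite expfzDr ?Qbase_neq0. Qed.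

Lemma QzB (m n : int) : Q ^ (m - n) = Q ^ m / Q ^ n.
Proof. by rewrite QzD -invr_expz. Qed.

Lemma Qpowz_neq0 (n : int) : Q ^ n != 0.
Proof. by rewrite expfz_neq0 ?Qbase_neq0. Qed.

Lemma qzD (m n : int) : q ^ (m + n) = q ^ m * q ^ n.
Proof. by rewrite expfzDr. Qed.

Lemma zzD (m n : int) : z ^ (m + n) = z ^ m * z ^ n.
Proof. by rewrite expfzDr. Qed.

Definition inv_qfact (m : int) : R[i] := (qpoch Q Q m)^-1.
Local Notation iQ := inv_qfact.
Definition inv_qpochA (m : int) : R[i] := (qpoch (z ^+ 2 * Q) Q m)^-1.
Local Notation iA := inv_qpochA.
Definition bailey_kernel (N n : int) : R[i] := iQ (N - n) * iA (N + n).
Local Notation ker := bailey_kernel.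

Lemma iQS m : iQ m = iQ (m + 1) * (1 - Q ^ (m + 1)).
Proof. by apply: qpochQVS; [exact: Qbase_neq0|exact: powQ_neq1]. Qed.

Lemma iQ_neg m : m < 0 -> iQ m = 0.
Proof. by apply: qpochQ_neg; exact: Qbase_neq0. Qed.

Lemma iQ0 : iQ 0 = 1.
Proof. by rewrite /iQ (qpochE _ _ 0) big_ord0 invr1. Qed.

Lemma iAS m : iA m = iA (m + 1) * (1 - z ^+ 2 * Q ^ (m + 1)).
Proof.
have e : z ^+ 2 * Q ^ (m + 1) = z ^+ 2 * Q * Q ^ m by rewrite QzD expr1z; ring.
by have := hzz (m + 1); rewrite e; apply: qpochVS.
Qed.

Lemma ker0 N n : N < n -> ker N n = 0.
Proof. by move=> h; rewrite /ker iQ_neg ?mul0r // subr_lt0. Qed.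

Lemma gb_iA : gb q absz (fun n => - neg2 n) iA.
Proof.
apply: gb_qpochV => // j; have := hzz (j%:Z + 1).
by rewrite QzD expr1z -mulrA [Q * _]mulrC.
Qed.

(** The kernel costs [neg2 (s + n)]. For s < 0 and s + n < 0 the exponent left is 3n^2 + 2s^2 - (s +
    n)^2 = n^2 + (n - s)^2, positive definite; the other sign patterns are easier. Without the
    summand [neg2 s] nothing would remain at n = 0. *)
Lemma summ_ker2 (al v : int -> R[i]) :
  gb q absz (fun n => 3 * n ^+ 2) al ->
  gb q absz (fun s => s ^+ 2 + neg2 s) v ->
  summ (fun p => al p.1 * v p.2 * ker p.2 p.1).
Proof.
move=> ha hv.
have h := gbM q0 (gbM q0 (gb_comp (fst : int * int -> int) ha)
   (gb_comp (snd : int * int -> int) hv))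
  (gbM q0 (gb_comp (fun p : int * int => p.2 - p.1) (gb_qpochQV q0 q1))
   (gb_comp (fun p : int * int => p.2 + p.1) gb_iA)).
apply: (@summ_gb2 _ q q0 q1 _ (fun p => 3 * p.1 ^+ 2 + (p.2 ^+ 2 + neg2 p.2)
   - neg2 (p.2 + p.1))).
  apply: (gb_weak q0 q1 (K := 2%N) h) => p _ /=.
  by split; lia.
case=> n s /=.
have [sn|ns _] := ltP s n; first by rewrite ker0 // mulr0 eqxx.
rewrite /neg2 !expr2; case: ifP => s0; case: ifP => sn0; nia.
Qed.

(** Here and in [gb_one_alpha], a nowhere vanishing family of the critical order: used as the other
    factor and then divided out, it reduces summability in one index to [summ_ker2]. *)
Lemma gb_one_weight : gb q absz (fun s => s ^+ 2 + neg2 s)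
  (fun s => q ^ (s ^+ 2 + neg2 s)).
Proof.
apply: (gb_weak q0 q1 (K := 1%N) (gb_qpowz q _)) => i _ /=; split; lia.
Qed.

Lemma gb_one_alpha : gb q absz (fun n => 3 * n ^+ 2) (fun n => q ^ (3 * n ^+ 2)).
Proof.
apply: (gb_weak q0 q1 (K := 1%N) (gb_qpowz q _)) => i _ /=; split; lia.
Qed.

Lemma summ_alpha al N : gb q absz (fun n => 3 * n ^+ 2) al ->
  summ (fun n => al n * ker N n).
Proof.
move=> ha; have [B /(absb_slice N) h] := summ_swap (summ_ker2 ha gb_one_weight).
have /(summZ (q ^ (N ^+ 2 + neg2 N))^-1) : summ (fun n =>
  al n * q ^ (N ^+ 2 + neg2 N) * ker N n) by exists B.
apply: summ_le => n; rewrite le_eqVlt; apply/orP; left; apply/eqP; congr nrm.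
have := @expfz_neq0 _ _ (N ^+ 2 + neg2 N) q0.
by move: (q ^ _) => x x0; field.
Qed.

Lemma summ_weight v n : gb q absz (fun s => s ^+ 2 + neg2 s) v ->
  summ (fun s => v s * ker s n).
Proof.
move=> hv; have [B /(absb_slice n) h] := summ_ker2 gb_one_alpha hv.
have /(summZ (q ^ (3 * n ^+ 2))^-1) : summ (fun s =>
  q ^ (3 * n ^+ 2) * v s * ker s n) by exists B.
apply: summ_le => s; rewrite le_eqVlt; apply/orP; left; apply/eqP; congr nrm.
have := @expfz_neq0 _ _ (3 * n ^+ 2) q0.
by move: (q ^ _) => x x0; field.
Qed.

(** The growth bound belongs to the notion: it makes the sums against any weight of order
    [s ^+ 2 + neg2 s] exchangeable. *)
Definition BP (al be : int -> R[i]) :=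
  gb q absz (fun n => 3 * n ^+ 2) al /\
  forall N, HS (fun n => al n * ker N n) (be N).

(** Bailey's transform: [v] and [la] form a conjugate pair, and the double sum of
    [al n * v s * ker s n] is evaluated in both orders. *)
Lemma BP_exchange al be v la : BP al be ->
  gb q absz (fun s => s ^+ 2 + neg2 s) v ->
  (forall n, HS (fun s => v s * ker s n) (la n)) ->
  exists S, HS (fun s => v s * be s) S /\ HS (fun n => al n * la n) S.
Proof.
move=> [ha hb] hv hla; have hs := summ_ker2 ha hv.
have [||S [h1 h2]] := HS_exchange (f := fun n s => al n * v s * ker s n)
  (g := fun n => al n * la n) (h := fun s => v s * be s) hs.
- by move=> n; apply: eq_HS (HSZ (al n) (hla n)) => s; rewrite mulrA.
- by move=> s; apply: eq_HS (HSZ (v s) (hb s)) => n; ring.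
by exists S.
Qed.

Definition layer_wt (s : int) : R[i] := z ^ (2 * s) * q ^ (2 * s ^+ 2).
Local Notation wt := layer_wt.

Lemma wtS s : wt (s + 1) = wt s * (z ^+ 2 * (Q ^ s) ^+ 2 * Q).
Proof.
rewrite /wt mulrDr zzD.
have -> : 2 * (s + 1) ^+ 2 = 2 * s ^+ 2 + (2 * s + 2 * s + 2) by ring.
rewrite !qzD -(QzE s) mulr1 -[z ^ 2]/(z ^+ 2) expr1z; ring.
Qed.

Lemma gb_wt : gb q absz (fun s => 2 * s ^+ 2) wt.
Proof.
apply: (gb_weak q0 q1 (K := 2%N) (gbM q0 (gb_powz q _ z0) (gb_qpowz q _))).
by move=> i _ /=; split; lia.
Qed.

Lemma gb_wt_iQ N : gb q absz (fun s => s ^+ 2 + neg2 s) (fun s => wt s * iQ (N - s)).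
Proof.
have h := gbM q0 gb_wt (gb_comp (fun s => N - s) (gb_qpochQV q0 q1)).
apply: (gb_weak q0 q1 (K := 1%N) h) => s _ /=; split; first by lia.
by have := neg2_le s; lia.
Qed.

Section Layer.
Variable n : int.

Let tau N s := wt s * iQ (N - s) * ker s n.
Let H N s := wt s * iQ (N - s) * Q ^ (N - s) * ker (s - 1) n.

Lemma layer_summ N : summ (tau N).
Proof. exact: summ_weight (gb_wt_iQ N). Qed.

Lemma layer_summH N : summ (fun s => H N (s + 1)).
Proof.
have h : gb q absz (fun s => s ^+ 2 + neg2 s)
    (fun s => wt (s + 1) * iQ (N - (s + 1)) * Q ^ (N - (s + 1))).
  have h := gbM q0 (gbM q0 (gb_comp (fun s => s + 1) gb_wt)
     (gb_comp (fun s => N - (s + 1)) (gb_qpochQV q0 q1)))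
     (gb_powz q (fun s => N - (s + 1)) (Qbase_neq0 q0)).
  apply: (gb_weak q0 q1 (K := (absz N + 10)%N) h) => s _ /=; split; first by lia.
  have := neg2_le s; rewrite !expr2; nia.
apply: summ_le (summ_weight n h) => s.
by rewrite /H addrK.
Qed.

(* The certificate of the recurrence in [N] satisfied by the inner sum. *)
Lemma layer_cert N s :
  (1 - Q ^ (N - n)) * (1 - z ^+ 2 * Q ^ (N + n)) * tau N s - tau (N - 1) s
  = H N s - H N (s + 1).
Proof.
rewrite /tau /H /ker addrK wtS.
have -> : iQ (N - 1 - s) = iQ (N - s) * (1 - Q ^ (N - s)).
  by rewrite iQS (_ : N - 1 - s + 1 = N - s) //; ring.
have -> : iQ (N - (s + 1)) = iQ (N - s) * (1 - Q ^ (N - s)).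
  by rewrite iQS (_ : N - (s + 1) + 1 = N - s) //; ring.
have -> : iQ (s - 1 - n) = iQ (s - n) * (1 - Q ^ (s - n)).
  by rewrite iQS (_ : s - 1 - n + 1 = s - n) //; ring.
have -> : iA (s - 1 + n) = iA (s + n) * (1 - z ^+ 2 * Q ^ (s + n)).
  by rewrite iAS (_ : s - 1 + n + 1 = s + n) //; ring.
rewrite !QzB !QzD expr1z.
have := Qpowz_neq0 s; have := Qpowz_neq0 n; have := Qbase_neq0 q0.
move: (wt s) (iQ _) (iQ _) (iA _) (Q ^ s) (Q ^ n) (Q ^ N) => w a b c X Y W.
by move=> *; field; apply/and3P.
Qed.

(** A limiting case of the q-Chu-Vandermonde sum. The terms live on n <= s <= N, so both sides
    vanish for N < n and reduce to the term s = n at N = n; from there the recurrence climbs. It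
    cannot lead from N = n - 1 to N = n, where its factor 1 - Q^(N-n) is zero. *)
Lemma layer_sum N : HS (fun s => wt s * iQ (N - s) * ker s n) (wt n * ker N n).
Proof.
have rec M L L' : HS (tau M) L -> HS (tau (M - 1)) L' ->
    (1 - Q ^ (M - n)) * (1 - z ^+ 2 * Q ^ (M + n)) * L = L'.
  move=> hL hL'.
  have := HSB (HSZ ((1 - Q ^ (M - n)) * (1 - z ^+ 2 * Q ^ (M + n))) hL) hL'.
  have := HS_telescope (layer_summH M) => /(HS_shift (-1)) /(HSZ (-1)).
  rewrite mulr0 => h1 h2; apply/eqP; rewrite -subr_eq0; apply/eqP.
  apply: HS_unique h2 _; apply: eq_HS h1 => s.
  by rewrite layer_cert /= subrK; ring.
have below M : M < n -> HS (tau M) (wt n * ker M n).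
  move=> Mn; have -> : wt n * ker M n = tau M n.
    by rewrite /tau ker0 // iQ_neg ?mulr0 ?mul0r //; lia.
  apply: HS_single => s _; rewrite /tau.
  have [sn|ns] := ltP s n; first by rewrite ker0 // mulr0.
  by rewrite iQ_neg ?mulr0 ?mul0r //; lia.
have [/below//|nN] := ltP N n.
have -> : N = n + (absz (N - n))%:Z by lia.
elim: (absz _) => [|k IH].
  have -> : wt n * ker (n + 0%:Z) n = tau (n + 0%:Z) n.
    by rewrite /tau addr0 subrr iQ0 mulr1.
  apply: HS_single => s sn; rewrite /tau.
  have [ltsn|ns] := ltP s n; first by rewrite ker0 // mulr0.
  by rewrite iQ_neg ?mulr0 ?mul0r //; lia.
have [L hL] := summ_HS (layer_summ (n + k.+1%:Z)).
have hk : n + k.+1%:Z - 1 = n + k%:Z by lia.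
have := rec _ _ _ hL; rewrite hk => /(_ _ IH) e.
suff -> : wt n * ker (n + k.+1%:Z) n = L by [].
have ek : ker (n + k%:Z) n = (1 - Q ^ (n + k.+1%:Z - n))
   * (1 - z ^+ 2 * Q ^ (n + k.+1%:Z + n)) * ker (n + k.+1%:Z) n.
  rewrite /ker -!hk.
  have -> : iQ (n + k.+1%:Z - 1 - n) = iQ (n + k.+1%:Z - n) * (1 - Q ^ (n + k.+1%:Z
    - n)).
    by rewrite iQS (_ : n + k.+1%:Z - 1 - n + 1 = n + k.+1%:Z - n) //; ring.
  have -> : iA (n + k.+1%:Z - 1 + n) = iA (n + k.+1%:Z + n) * (1 - z ^+ 2 * Q ^ (n
    + k.+1%:Z + n)).
    by rewrite iAS (_ : n + k.+1%:Z - 1 + n + 1 = n + k.+1%:Z + n) //; ring.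
  by ring.
have ne0 : (1 - Q ^ (n + k.+1%:Z - n)) * (1 - z ^+ 2 * Q ^ (n + k.+1%:Z + n)) != 0.
  rewrite mulf_neq0 // (_ : n + k.+1%:Z - n = k.+1%:Z); last by ring.
  by rewrite -exprnP exprS; exact: powQ_neq1.
apply: (mulfI ne0); rewrite e ek; ring.
Qed.

End Layer.

Lemma BP_layer al be : BP al be ->
  exists be', (forall N, HS (fun s => wt s * iQ (N - s) * be s) (be' N)) /\
    BP (fun n => wt n * al n) be'.
Proof.
move=> hab; have [ha _] := hab.
have h N := BP_exchange hab (gb_wt_iQ N) (fun n => layer_sum n N).
pose be' N := projT1 (cid (h N)).
have hb N : HS (fun s => wt s * iQ (N - s) * be s) (be' N) /\
    HS (fun n => al n * (wt n * ker N n)) (be' N).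
  by rewrite /be'; case: cid.
exists be'; split=> [N|]; first by case: (hb N).
split=> [|N].
  apply: (gb_weak q0 q1 (K := 2%N) (gbM q0 gb_wt ha)) => i _ /=.
  by split; [lia|have := sqr_ge0 i; lia].
by have [_] := hb N; apply: eq_HS => n; ring.
Qed.

(** Neighbouring kernels satisfy (1 - Q^(s-n+1)) k_s(n-1) = (1 - z^2 Q^(s+n)) k_s(n). Hence the new
    summand and Q^s times the old one differ by a telescoping difference of (Q^n - Q^s) g_n
    k_s(n). *)
Lemma BP_shift g be : gb q absz (fun n => 3 * n ^+ 2) g ->
  BP (fun n => g n - z ^+ 2 * Q ^ (2 * n - 1) * g (n - 1)) be ->
  BP (fun n => Q ^ n * g n - Q ^ (n - 1) * g (n - 1)) (fun s => Q ^ s * be s).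
Proof.
move=> hg [_ hb]; have hg1 := gb_shift q0 q1 hg; split=> [|s].
  apply: gbD; last apply: gbN => //.
    by apply: (gb_linear q0 q1 (K := 1%N)) => // [|n]; [exact: Qbase_neq0|lia].
  by apply: (gb_linear q0 q1 (K := 1%N)) => // [|n]; [exact: Qbase_neq0|lia].
pose H n := (Q ^ n * g n - Q ^ s * g n) * ker s n.
have sH : summ H.
  apply: summ_alpha; apply: gbD; last by apply: gbN => //; apply: gbZ.
  by apply: (gb_linear q0 q1 (K := 1%N)) => // [|n]; [exact: Qbase_neq0|lia].
have hH := HS_shift (-1) (HS_telescope sH).
have := HSD (HSZ (Q ^ s) (hb s)) hH; rewrite addr0; apply: eq_HS => n.
rewrite /H subrK /ker.
have -> : s - (n - 1) = s - n + 1 by ring.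
rewrite (iQS (s - n)).
have e1 : iA (s + (n - 1)) = iA (s + n) * (1 - z ^+ 2 * Q ^ (s + n)).
  by rewrite iAS (_ : s + (n - 1) + 1 = s + n) //; ring.
rewrite e1.
have -> : Q ^ (2 * n - 1) = Q ^ n * Q ^ n / Q.
  by rewrite mulr_natl mulr2n QzB QzD expr1z.
rewrite (QzD (s - n)) !QzB QzD expr1z.
have := Qpowz_neq0 s; have := Qpowz_neq0 n; have := Qbase_neq0 q0.
move: (g n) (g (n - 1)) (iQ _) (iA _) (Q ^ s) (Q ^ n) => a b c d X Y.
by move=> Qn0 Y0 _; field; rewrite q0 Y0.
Qed.

End Kernel.

(** * Reading off constants by dominated limits *)

Section Limits.
Variable R : realType.

Lemma cv_int (u : int -> R[i]) l (g : nat -> int) (k : int) :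
  cv \oo (fun n : nat => u n) l -> (forall n : nat, n%:Z + k <= g n) ->
  cv \oo (fun n : nat => u (g n)) l.
Proof.
move=> ul hg e e0; have [N _ hN] := ul _ e0.
exists (N + absz k)%N => // n /= nN; have := hg n => h.
have -> : g n = (absz (g n))%:Z by lia.
by apply: (hN (absz (g n))) => /=; lia.
Qed.

Variable q : R[i].
Hypotheses (q0 : q != 0) (q1 : nrm q < 1).

Lemma cv_powz0 (m : int) : 0 < m ->
  cv \oo (fun M : nat => q ^ (2 * M%:Z * m)) 0.
Proof.
move=> m0; have h : nrm (q ^+ (2 * absz m)) < 1.
  by rewrite nrmX exprn_ilt1 ?nrm_ge0 //; lia.
apply: eq_cv (cv_pow h) => M; rewrite -exprM exprnP; congr (_ ^ _); lia.
Qed.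

(** The sum does not depend on [M] although its terms do: when all terms but [m = 0] fade, the limit
    of that one is the value. The constants of the theta series, the initial pair and the outermost
    sum are found in this way. *)
Lemma tannery_zero (f : nat -> int -> R[i]) (e : nat * int -> int) S L :
  gb q (fun p : nat * int => absz p.2) e (fun p => f p.1 p.2) ->
  (forall M m, f M m != 0 -> m ^+ 2 <= 4 * e (M, m)) ->
  (forall M, HS (f M) S) ->
  (forall M m, m < 0 -> f M m = 0) ->
  (forall m, 0 < m -> cv \oo (fun M => f M m) 0) ->
  cv \oo (fun M => f M 0) L -> S = L.
Proof.
move=> hf he hS hneg hpos h0.
have [b [B [hB hb]]] := dominated_gb q0 q1 hf he.
pose g (m : int) := if m == 0 then L else 0.
have hg : HS g L.
  have -> : L = g 0 by rewrite /g eqxx.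
  by apply: HS_single => m m0; rewrite /g (negbTE m0).
apply: (@cv_unique R nat \oo _ (fun=> S)); first exact: cv_cst.
apply: (tannery (s := fun=> S) hB hb _ hS hg) => m; rewrite /g.
have [->//|m0] := eqVneq m 0.
have [mneg|mpos] := ltP m 0; last by apply: hpos; lia.
by apply: eq_cv (cv_cst 0) => M; rewrite hneg.
Qed.

End Limits.

Section JacobiTripleProduct.
Variables (R : realType) (p x : R[i]).
Hypotheses (p0 : p != 0) (p1 : nrm p < 1) (x0 : x != 0).
Local Notation P := (p ^+ 2).

(** With base P = p^2 the usual coefficient (-x)^n P^(n(n-1)/2) needs no halved exponent. *)
Let c (n : int) : R[i] := (- x) ^ n * p ^ (n ^+ 2 - n).

Let nx0 : - x != 0. Proof. by rewrite oppr_eq0. Qed.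

Lemma theta_coefS n : c (n + 1) = c n * (- x * P ^ n).
Proof.
rewrite /c expfzDr // expr1z QzE //.
have -> : (n + 1) ^+ 2 - (n + 1) = (n ^+ 2 - n) + 2 * n by ring.
by rewrite (qzD p0); ring.
Qed.

Lemma gb_theta : gb p absz (fun n => n ^+ 2) c.
Proof.
apply: (gb_weak p0 p1 (K := 1%N) (gbM p0 (gb_powz p _ nx0) (gb_qpowz p _))).
by move=> n _ /=; split; lia.
Qed.

Let iP := inv_qfact p.

Lemma gb_theta_iP : gb p (fun a : int * int => absz a.2) (fun a => a.2 ^+ 2)
  (fun a => c a.2 * iP (a.1 - a.2)).
Proof.
have h := gbM p0 (gb_comp (snd : int * int -> int) gb_theta)
  (gb_comp (fun a : int * int => a.1 - a.2) (gb_qpochQV p0 p1)).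
by apply: (gb_weak p0 p1 (K := 1%N) h) => a _ /=; split; lia.
Qed.

Lemma summ_theta_iP N : summ (fun n => c n * iP (N - n)).
Proof.
apply: (summ_gb p0 p1 (gb_comp (fun n : int => (N, n)) gb_theta_iP)) => n _ /=.
by rewrite expr2; nia.
Qed.

Let h N := projT1 (cid (summ_HS (summ_theta_iP N))).

Let hE N : HS (fun n => c n * iP (N - n)) (h N).
Proof. by rewrite /h; case: cid. Qed.

(** * Jacobi's triple product *)
(* [h N = sum_n c n / (P; P)_(N - n)]: as [N -> +oo] it tends to the theta series
   divided by [(P; P)_oo], and as [N -> -oo] a single term survives. *)
Lemma theta_rec N : h (N + 1) = (1 - x * P ^ N) * h N.
Proof.
apply: HS_unique (hE _) _.
have h1 := HSZ (- x * P ^ N) (hE N).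
have h2 := HSD (hE N) (HS_shift (-1) h1).
have -> : (1 - x * P ^ N) * h N = h N + - x * P ^ N * h N by ring.
apply: eq_HS h2 => n /=.
have e1 : iP (N - n) = iP (N + 1 - n) * (1 - P ^ (N + 1 - n)).
  by rewrite /iP iQS // (_ : N - n + 1 = N + 1 - n) //; ring.
have e2 : c n = c (n - 1) * (- x * P ^ (n - 1)) by rewrite -theta_coefS subrK.
have e3 : N - (n + -1) = N + 1 - n by ring.
rewrite e3 e1 e2 !(QzB p0) !(QzD p0) expr1z.
have := Qpowz_neq0 p0 n; have := Qbase_neq0 p0; move: (c _) (iP _) (P ^ n) (P ^ N)
  => a b X Y.
by move=> P0 X0; field; rewrite p0 X0.
Qed.

Lemma theta_pos (N : nat) : h N = qpoch x P N * h 0.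
Proof.
elim: N => [|N IH]; first by rewrite qpochE big_ord0 mul1r.
by rewrite -addn1 PoszD theta_rec IH qpochS //; ring.
Qed.

(** The coefficient at index -M - m, times the product that links [h (- M)] to [h 0]. The powers of
    x and p depending on M alone cancel; the surviving p^(2Mm) kills every m > 0 as M grows. *)
Let d (M : nat) (m : int) : R[i] :=
  qpoch (P / x) P M * (- x) ^ (- m) * p ^ (m ^+ 2 + m + 2 * M%:Z * m).

Lemma theta_neg (M : nat) : HS (fun m => d M m * iP m) (h 0).
Proof.
pose b (M : nat) := \prod_(j < M) (1 - x * P ^ (- (j%:Z + 1))).
have hb : h 0 = b M * h (- M%:Z).
  rewrite /b; elim: M => [|M ->]; first by rewrite big_ord0 mul1r.
  rewrite big_ord_recr /= -mulrA; congr (_ * _).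
  have -> : - M%:Z = - M.+1%:Z + 1 by lia.
  by rewrite theta_rec; congr ((1 - x * P ^ _) * _); lia.
have hd m : b M * c (- M%:Z - m) = d M m.
  rewrite /b /d; elim: M {hb} => [|M IH].
    rewrite big_ord0 qpochE big_ord0 !mul1r /c; congr (_ * _).
      by congr (_ ^ _); lia.
    by congr (_ ^ _); rewrite sub0r mulr0 mul0r; ring.
  have -> : M.+1%:Z = M%:Z + 1 by lia.
  rewrite big_ord_recr qpochS // -[nat_of_ord ord_max]/M.
  have e1 : c (- M%:Z - m) = c (- (M%:Z + 1) - m) * (- x * P ^ (- (M%:Z + 1) - m)).
    by rewrite -theta_coefS; congr c; ring.
  have e2 : p ^ (m ^+ 2 + m + 2 * (M%:Z + 1) * m) = p ^ (m ^+ 2 + m + 2 * M%:Z * m)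
    * P ^ m.
    by rewrite QzE -(qzD p0); congr (_ ^ _); ring.
  rewrite e2.
  have -> : c (- (M%:Z + 1) - m) = c (- M%:Z - m) * (- x * P ^ (- (M%:Z + 1) - m))^-1.
    by rewrite e1 mulfK // mulf_neq0 // Qpowz_neq0.
  have -> : forall A B C : R[i], A * (1 - B) * (c (- M%:Z - m) * C)
    = (A * c (- M%:Z - m)) * ((1 - B) * C) by move=> *; ring.
  have e3 : P ^ (- (M%:Z + 1)) = (P ^ M%:Z * P)^-1.
    by rewrite -invr_expz (QzD p0) expr1z.
  rewrite IH !(QzB p0) e3.
  have := Qpowz_neq0 p0 m; have := Qpowz_neq0 p0 M%:Z.
  move: (qpoch _ _ _) ((- x) ^ (- m)) (p ^ _) (P ^ M%:Z) (P ^ m) => A B D X Y X0 Y0.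
  by field; rewrite x0 p0 X0 Y0.
rewrite hb; have hM := HSZ (b M) (hE (- M%:Z)).
have := HS_reindex_bij (h := fun m => - M%:Z - m) (h' := fun m => - M%:Z - m) _ _ hM.
move=> hM2; apply: eq_HS (hM2 _ _) => m /=; last 2 first.
- by ring.
- by ring.
by rewrite -hd mulrA; congr (_ * iP _); ring.
Qed.

Lemma theta_h0 : h 0 = qpoch_inf (P / x) P.
Proof.
have P1 := nrmQ_lt1 p1; have [C hC] := qpoch_bounded (P / x) P1.
apply: (@tannery_zero _ p p0 p1 (fun M m => d M m * iP m)
  (fun a => a.2 ^+ 2 + a.2 + 2 * a.1%:Z * a.2 - a.2) _ _ _ _ theta_neg).
- have hq : gb p (fun=> 0%N) (fun=> 0) (fun M : nat => qpoch (P / x) P M).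
    exact: gb_bounded hC.
  have g := gbM p0 (gbM p0 (gbM p0 (gb_comp (fst : nat * int -> nat) hq)
     (gb_powz p (fun a : nat * int => - a.2) nx0)) (gb_qpowz p
     (fun a : nat * int => a.2 ^+ 2 + a.2 + 2 * a.1%:Z * a.2)))
     (gb_comp (snd : nat * int -> int) (gb_qpochQV p0 p1)).
  by apply: (gb_weak p0 p1 (K := 1%N) g) => a _ /=; split; lia.
- move=> M m; have [m0|m0 _] := ltP m 0; first by rewrite /iP iQ_neg // mulr0 eqxx.
  by rewrite /= expr2; nia.
- by move=> M m m0; rewrite /iP iQ_neg // mulr0.
- move=> m m0.
  have h1 : forall M : nat, nrm (qpoch (P / x) P M * ((- x) ^ (- m) * p ^ (m ^+ 2 +
    m) * iP m))
     <= C * nrm ((- x) ^ (- m) * p ^ (m ^+ 2 + m) * iP m).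
    by move=> M; rewrite nrmM ler_wpM2r ?nrm_ge0.
  apply: eq_cv (cvM0 h1 (cv_powz0 p0 p1 m0)) => M.
  by rewrite /d (qzD p0 (m ^+ 2 + m)); ring.
apply: eq_cv (qpoch_inf_cv (P / x) P1) => M.
by rewrite /d /iP iQ0 expr0n addr0 mulr0 addr0 oppr0 !expr0z !mulr1.
Qed.

Theorem jacobi_triple_product :
  HS (fun n => (- x) ^ n * p ^ (n ^+ 2 - n))
     (qpoch_inf P P * (qpoch_inf x P * qpoch_inf (P / x) P)).
Proof.
have P1 := nrmQ_lt1 p1.
have [Pn0 hPi] := qpochV_inf_cv P1 (powQ_neq1 p1).
have [S hS] : exists S, HS c S.
  by apply: summ_HS; apply: (summ_gb p0 p1 gb_theta) => n _; rewrite expr2; nia.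
have [b [B [hB hb]]] := dominated_gb (f := fun (N : nat) n => c n * iP (N%:Z - n))
  p0 p1 (gb_comp (fun a : nat * int => (a.1%:Z, a.2)) gb_theta_iP)
  (fun _ n _ => ltac:(rewrite /= expr2; nia)).
have hcv : cv \oo (fun N : nat => h N) (S * (qpoch_inf P P)^-1).
  apply: (tannery (f := fun (N : nat) n => c n * iP (N%:Z - n))
    (g := fun n => (qpoch_inf P P)^-1 * c n) hB hb) => [n|N|].
  - rewrite mulrC; apply: cvZ.
    apply: (cv_int (u := iP) (g := fun N : nat => N%:Z - n) (k := - n) hPi).
    by move=> N; lia.
  - exact: hE.
  - by rewrite mulrC; apply: HSZ.
have hcv2 : cv \oo (fun N : nat => h N) (h 0 * qpoch_inf x P).
  apply: eq_cv (cvZ (h 0) (qpoch_inf_cv x P1)) => N.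
  by rewrite theta_pos mulrC.
have e := cv_unique hcv hcv2.
have -> : qpoch_inf P P * (qpoch_inf x P * qpoch_inf (P / x) P) = S.
  by rewrite -theta_h0 [qpoch_inf x P * _]mulrC -e mulrC divfK.
exact: hS.
Qed.

End JacobiTripleProduct.

Lemma int_constant (T : Type) (r : int -> T) :
  (forall n, r (n + 1) = r n) -> forall n, r n = r 0.
Proof.
move=> h; case=> n.
  by elim: n => // n <-; rewrite -addn1 PoszD h.
rewrite NegzE; elim: n => [|n <-]; first by rewrite -(h (- 1)).
by rewrite -(h (- n.+2%:Z)); congr r; lia.
Qed.

Lemma qpoch_neq0_int (F : fieldType) (x Q : F) :
  (forall n : int, 1 - x * Q ^ n != 0) -> forall n, qpoch x Q n != 0.
Proof.
move=> h; case=> n; rewrite /qpoch.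
  rewrite big_add1 /= big_mkord; apply/prodf_neq0 => i _; exact: (h i).
rewrite big_add1 /= big_mkord; apply/prodf_neq0 => i _; rewrite invr_neq0 //.
exact: (h (Negz i)).
Qed.

(** * The two ends of the chain: innermost factor and outermost weight *)

Section BaseAndOuter.
Variables (R : realType) (q z : R[i]).
Hypotheses (q0 : q != 0) (q1 : nrm q < 1) (z0 : z != 0).
Local Notation Q := (q ^+ 2).
Hypothesis hzz : forall n : int, 1 - z ^+ 2 * Q ^ n != 0.
Local Notation iQ := (inv_qfact q).
Local Notation iA := (inv_qpochA q z).
Local Notation ker := (bailey_kernel q z).
Local Notation qzD := (qzD q0).
Local Notation QzD := (QzD q0).
Local Notation QzB := (QzB q0).
Local Notation Qpowz_neq0 := (Qpowz_neq0 q0).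
Local Notation zzD := (zzD z0).

(** 1 - z Q^n divides 1 - z^2 Q^(2n). *)
Lemma one_sub_zQz_neq0 (n : int) : 1 - z * Q ^ n != 0.
Proof.
have := hzz (n + n); apply: contra_neq; rewrite QzD => h.
have e : z * Q ^ n = 1 by apply/esym/eqP; rewrite -subr_eq0 h.
have -> : z ^+ 2 * (Q ^ n * Q ^ n) = (z * Q ^ n) ^+ 2 by ring.
by rewrite e expr1n subrr.
Qed.

Lemma one_sub_zVQ_neq0 (j : nat) : 1 - z^-1 * Q ^+ j != 0.
Proof.
have := one_sub_zQz_neq0 (- j%:Z); apply: contra_neq => h.
have e : z^-1 * Q ^+ j = 1 by apply/esym/eqP; rewrite -subr_eq0 h.
have Qj : Q ^+ j != 0 by rewrite expf_neq0 ?Qbase_neq0.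
have -> : z = Q ^+ j by apply: (mulfI (invr_neq0 z0)); rewrite e mulVf.
by rewrite -exprnN mulfV // subrr.
Qed.

(** Reflection formula. It turns symbols of negative index, met as N -> -oo, into symbols of
    nonnegative index, whose limits are known. *)
Lemma qpoch_reflect x (k : nat) : x != 0 -> (forall n : int, 1 - x * Q ^ n != 0) ->
  (qpoch (x * Q) Q (- k%:Z))^-1
  = (- x) ^ k%:Z * q ^ (- (k%:Z ^+ 2 - k%:Z)) * qpoch x^-1 Q k.
Proof.
move=> x0 hx; elim: k => [|k IH].
  by rewrite oppr0 !expr0z !(qpochE _ _ 0) !big_ord0 invr1 !mulr1.
have h : 1 - x * Q * Q ^ (- k.+1%:Z) != 0.
  have := hx (- k%:Z); have -> : - k%:Z = - k.+1%:Z + 1 by lia.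
  by rewrite QzD expr1z; congr (1 - _ != 0); ring.
rewrite qpochVS //.
have -> : - k.+1%:Z + 1 = - k%:Z by lia.
have -> : k.+1%:Z = k%:Z + 1 by lia.
rewrite IH qpochS //.
have -> : q ^ (- ((k%:Z + 1) ^+ 2 - (k%:Z + 1))) = q ^ (- (k%:Z ^+ 2 - k%:Z)) / Q ^
  k%:Z.
  by rewrite QzE invr_expz -qzD; congr (_ ^ _); ring.
have -> : Q ^ (- (k%:Z + 1)) = (Q ^ k%:Z * Q)^-1 by rewrite -invr_expz QzD expr1z.
rewrite expfzDr ?oppr_eq0 // expr1z.
have := Qpowz_neq0 k%:Z.
move: ((- x) ^ _) (q ^ _) (qpoch _ _ _) (Q ^ k%:Z) => a b c X X0.
by field; rewrite x0 q0 X0.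
Qed.

(** In powers of Q this is (-1)^n z^(3n) Q^(n(3n-1)/2), with the exponents of Euler's pentagonal
    number series. *)
Definition penta (n : int) : R[i] := (- z ^+ 3) ^ n * q ^ (3 * n ^+ 2 - n).

Lemma pentaS n : penta (n + 1) = penta n * (- z ^+ 3 * (Q ^ n) ^+ 3 * Q).
Proof.
have nz : - z ^+ 3 != 0 by rewrite oppr_eq0 expf_neq0.
rewrite /penta expfzDr // expr1z.
have -> : 3 * (n + 1) ^+ 2 - (n + 1) = (3 * n ^+ 2 - n) + (2 * n + 2 * n + 2 * n +
  2) by ring.
rewrite !(qzD _ (2 * n + 2 * n + 2 * n + 2)) !(qzD _ 2) !(qzD _ (2 * n)) -!(QzE q n).
by rewrite -[q ^ 2]/(q ^+ 2); ring.
Qed.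

Lemma gb_penta : gb q absz (fun n => 3 * n ^+ 2) penta.
Proof.
have nz : - z ^+ 3 != 0 by rewrite oppr_eq0 expf_neq0.
apply: (gb_weak q0 q1 (K := 1%N) (gbM q0 (gb_powz q _ nz) (gb_qpowz q _))).
by move=> n _ /=; split; lia.
Qed.

(** * The initial Bailey pair *)
Definition base_alpha (n : int) : R[i] := penta n * (1 + z * Q ^ n).

Lemma gb_base_alpha : gb q absz (fun n => 3 * n ^+ 2) base_alpha.
Proof.
apply: (eq_gb (f := fun n => penta n + z * (Q ^ n * penta n))).
  by move=> n; rewrite /base_alpha; ring.
apply: gbD gb_penta _; apply: (gbZ q0 q1).
by apply: (gb_linear q0 q1 (K := 1%N)) gb_penta => [|n]; [exact: Qbase_neq0|lia].
Qed.

(** The certificate z^3 Q^(N+n) (Q^n - Q^N) [penta n * ker N n] of the recurrence in N, expanded so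
    that the growth bounds apply termwise. *)
Let G N n := z ^+ 3 * (Q ^ N * (Q ^ n * (Q ^ n * penta n))
  - (Q ^ N) ^+ 2 * (Q ^ n * penta n)) * ker N n.

Lemma base_summG N : summ (G N).
Proof.
have h1 : gb q absz (fun n => 3 * n ^+ 2) (fun n => Q ^ n * penta n).
  by apply: (gb_linear q0 q1 (K := 1%N)) gb_penta => [|n]; [exact: Qbase_neq0|lia].
have h2 : gb q absz (fun n => 3 * n ^+ 2) (fun n => Q ^ n * (Q ^ n * penta n)).
  by apply: (gb_linear q0 q1 (K := 1%N)) h1 => [|n]; [exact: Qbase_neq0|lia].
apply: (summ_alpha q0 q1 z0 hzz); apply: (gbZ q0 q1); apply: gbD.
  by apply: (gbZ q0 q1).
by apply: (gbN q0 q1); apply: (gbZ q0 q1).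
Qed.

Lemma base_cert N n :
  (1 - z * Q ^ N) * (base_alpha n * ker N n) - base_alpha n * ker (N - 1) n
  = G N n - G N (n - 1).
Proof.
have eu : penta n = penta (n - 1) * (- z ^+ 3 * (Q ^ n / Q) ^+ 3 * Q).
  by rewrite -[in LHS](subrK 1 n) pentaS QzB expr1z.
have e1 : iQ (N - n) = iQ (N - n + 1) * (1 - Q ^ (N - n + 1)) by rewrite -iQS.
have e2 : iQ (N - 1 - n) = iQ (N - n) * (1 - Q ^ (N - n)).
  by rewrite iQS // (_ : N - 1 - n + 1 = N - n) //; ring.
have e3 : iA (N + n - 1) = iA (N + n) * (1 - z ^+ 2 * Q ^ (N + n)).
  by rewrite iAS // subrK.
have e4 : N - 1 + n = N + n - 1 by ring.
have e5 : N + (n - 1) = N + n - 1 by ring.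
have e6 : N - (n - 1) = N - n + 1 by ring.
rewrite /G /base_alpha /bailey_kernel e4 e5 e6 e2 e1 e3 eu (QzD (N - n)) !QzB !QzD
  expr1z.
have := Qpowz_neq0 n.
move: (penta _) (iQ _) (iA _) (Q ^ N) (Q ^ n) => u a c Y X X0.
by field; rewrite q0 X0.
Qed.

Let f N := projT1 (cid (summ_HS (summ_alpha q0 q1 z0 hzz N gb_base_alpha))).
Let fE N : HS (fun n => base_alpha n * ker N n) (f N).
Proof. by rewrite /f; case: cid. Qed.

Lemma base_rec N : (1 - z * Q ^ N) * f N = f (N - 1).
Proof.
have h := HSB (HSZ (1 - z * Q ^ N) (fE N)) (fE (N - 1)).
have h2 := HS_shift (-1) (HS_telescope (base_summG N)).
apply/eqP; rewrite -subr_eq0; apply/eqP; apply: HS_unique h _.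
by apply: eq_HS h2 => n /=; rewrite base_cert subrK.
Qed.

Let qB N := qpoch (z * Q) Q N.

Lemma qB_factor N : 1 - z * Q * Q ^ N != 0.
Proof. by have := one_sub_zQz_neq0 (N + 1); rewrite QzD expr1z -mulrA [Q * _]mulrC. Qed.

Lemma qB_neq0 N : qB N != 0.
Proof. exact: qpoch_neq0_int qB_factor N. Qed.

Lemma base_const N : f N * qB N = f 0.
Proof.
have -> : f 0 = f 0 * qB 0 by rewrite /qB (qpochE _ _ 0) big_ord0 mulr1.
apply: (int_constant (r := fun N => f N * qB N)) => n.
rewrite /qB qpochS; last by move=> _; apply: qB_factor.
have := base_rec (n + 1); rewrite addrK => <-.
by rewrite QzD expr1z; ring.
Qed.

(** The bounded part of the reflected term. [absz] only casts indices to naturals: for m < 0, where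
    it could alter them, [iQ m] vanishes. *)
Let D (M : nat) (m : int) : R[i] :=
  (1 + z^-1 * Q ^+ absz (M%:Z + m)) * qpoch (z ^+ 2)^-1 Q (absz (2 * M%:Z + m))
  * (qpoch z^-1 Q M)^-1.

Let T (M : nat) (m : int) : R[i] :=
  z ^ (1 - m) * q ^ (2 * m ^+ 2 + 2 * M%:Z * m) * D M m * iQ m.

(** Substitution n = -M - m with every symbol reflected: the exponents quadratic in M cancel and
    q^(2m^2 + 2Mm) is left. *)
Lemma base_term (M : nat) (m : int) :
  base_alpha (- M%:Z - m) * ker (- M%:Z) (- M%:Z - m) * qB (- M%:Z) = T M m.
Proof.
rewrite /T /D /bailey_kernel.
have -> : - M%:Z - (- M%:Z - m) = m by ring.
have [m0|m0] := ltP m 0; first by rewrite iQ_neg // !(mulr0, mul0r).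
set k := absz (2 * M%:Z + m).
have -> : - M%:Z + (- M%:Z - m) = - k%:Z by rewrite /k; lia.
have zz0 : z ^+ 2 != 0 by rewrite expf_neq0.
rewrite /inv_qpochA qpoch_reflect //.
have -> : qB (- M%:Z) = ((- z) ^ M%:Z * q ^ (- (M%:Z ^+ 2 - M%:Z)) * qpoch z^-1 Q M)^-1.
  by rewrite -qpoch_reflect ?invrK //; exact: one_sub_zQz_neq0.
rewrite /base_alpha /penta.
set w := M%:Z + m; have ew : - M%:Z - m = - w by rewrite /w; ring.
have ek : k%:Z = M%:Z + w by rewrite /k /w; lia.
have -> : Q ^+ absz w = Q ^ w by rewrite exprnP; congr (_ ^ _); rewrite /w; lia.
have -> : z ^ (1 - m) = z * (z ^ M%:Z / z ^ w).
  by rewrite invr_expz -zzD -[X in X * _]expr1z -zzD; congr (_ ^ _); rewrite /w; ring.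
have nz : - z != 0 by rewrite oppr_eq0.
have -> : (- z ^+ 2) ^ k%:Z = (- z) ^ M%:Z * z ^ M%:Z * ((- z) ^ w * z ^ w).
  rewrite ek (_ : - z ^+ 2 = (- z) * z); last by ring.
  by rewrite expfzDr ?mulf_neq0 // !exprMz_comm ?unitfE //; apply: mulrC.
have -> : (- z ^+ 3) ^ (- M%:Z - m) = ((- z) ^ w * z ^ w * z ^ w)^-1.
  rewrite ew (_ : - z ^+ 3 = (- z) * z * z); last by ring.
  by rewrite -invr_expz !exprMz_comm ?unitfE ?mulf_neq0 //; apply: mulrC.
have -> : q ^ (2 * m ^+ 2 + 2 * M%:Z * m) = q ^ (3 * (- M%:Z - m) ^+ 2 - (- M%:Z - m))
   * (Q ^ w)^-1 * q ^ (- (k%:Z ^+ 2 - k%:Z)) * (q ^ (- (M%:Z ^+ 2 - M%:Z)))^-1.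
  rewrite !invr_expz QzE -!qzD; congr (_ ^ _); rewrite ek /w; ring.
rewrite ew -[Q ^ (- w)]invr_expz.
have := @expfz_neq0 _ _ w nz; have := @expfz_neq0 _ _ M%:Z nz.
have := @expfz_neq0 _ _ w z0; have := @expfz_neq0 _ _ M%:Z z0; have := Qpowz_neq0 w.
have := @expfz_neq0 _ _ (- (M%:Z ^+ 2 - M%:Z)) q0.
have := qpoch_neq0 M one_sub_zVQ_neq0.
move: (qpoch z^-1 Q M) (qpoch (z ^- 2) Q k) (iQ m) (q ^ (- (M%:Z ^+ 2 - M%:Z)))
 (q ^ (- (k%:Z ^+ 2 - k%:Z))) (q ^ (3 * _ - _)) (Q ^ w) (z ^ M%:Z) (z ^ w) ((- z) ^
   M%:Z)
 ((- z) ^ w) => a b c x1 x2 x3 X z1 z2 z3 z4 *.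
by field; do ?[apply/andP; split].
Qed.

Lemma base_D_bounded : exists C : R, forall M m, nrm (D M m) <= C.
Proof.
have Q1 := nrmQ_lt1 q1.
have [C1 h1] := qpoch_bounded (z ^+ 2)^-1 Q1; have [C2 h2] := qpochV_bounded Q1
  one_sub_zVQ_neq0.
exists ((1 + nrm z^-1) * C1 * C2) => M m; rewrite !nrmM.
apply: ler_pM; rewrite ?mulr_ge0 ?nrm_ge0 //; apply: ler_pM; rewrite ?nrm_ge0 //.
apply: le_trans (nrmD _ _) _; rewrite nrm1 lerD2l nrmM ler_piMr ?nrm_ge0 //.
by rewrite nrmX exprn_ile1 ?nrm_ge0 // ltW.
Qed.

(* As [M -> oo] only the term [m = 0] of [T M] survives. *)
Lemma base_value : f 0 = z * (qpoch_inf (z ^+ 2)^-1 Q / qpoch_inf z^-1 Q).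
Proof.
have Q1 := nrmQ_lt1 q1; have [C hC] := base_D_bounded.
apply: (@tannery_zero _ q q0 q1 T (fun a => 2 * a.2 ^+ 2 + 2 * a.1%:Z * a.2)).
- have hD : gb q (fun=> 0%N) (fun=> 0) (fun a : nat * int => D a.1 a.2).
    by apply: (@gb_bounded _ _ _ _ C) => a; apply: hC.
  have g := gbM q0 (gbM q0 (gbM q0 (gb_powz q (fun a : nat * int => 1 - a.2) z0)
    (gb_qpowz q (fun a : nat * int => 2 * a.2 ^+ 2 + 2 * a.1%:Z * a.2))) hD)
    (gb_comp (snd : nat * int -> int) (gb_qpochQV q0 q1)).
  by apply: (gb_weak q0 q1 (K := 1%N) g) => a _ /=; split; lia.
- move=> M m; have [m0|m0 _] := ltP m 0; first by rewrite /T iQ_neg // mulr0 eqxx.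
  by rewrite /= expr2; nia.
- move=> M; rewrite -(base_const (- M%:Z)).
  have h := HSZ (qB (- M%:Z)) (fE (- M%:Z)).
  have := HS_reindex_bij (h := fun m => - M%:Z - m) (h' := fun m => - M%:Z - m) _ _ h.
  rewrite [f _ * _]mulrC => h2; apply: eq_HS (h2 _ _) => m /=; last 2 first.
  + by ring.
  + by ring.
  by rewrite -base_term mulrC.
- by move=> M m m0; rewrite /T iQ_neg // mulr0.
- move=> m m0.
  have h1 M : nrm (D M m * (z ^ (1 - m) * q ^ (2 * m ^+ 2) * iQ m))
     <= C * nrm (z ^ (1 - m) * q ^ (2 * m ^+ 2) * iQ m).
    by rewrite nrmM ler_wpM2r ?nrm_ge0.
  apply: eq_cv (cvM0 h1 (cv_powz0 q0 q1 m0)) => M.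
  by rewrite /T (qzD (2 * m ^+ 2)); ring.
have hD : cv \oo (fun M => D M 0)
    ((1 + z^-1 * 0) * qpoch_inf (z ^+ 2)^-1 Q * (qpoch_inf z^-1 Q)^-1).
  apply: cvM; last by have [] := qpochV_inf_cv Q1 one_sub_zVQ_neq0.
  apply: cvM.
    apply: cvD; first exact: cv_cst.
    apply: cvZ; apply: eq_cv (cv_pow Q1) => M; congr (_ ^+ _); lia.
  apply: (cv_int (g := fun M : nat => absz (2 * M%:Z + 0)) (k := 0)
     (qpoch_inf_cv (z ^+ 2)^-1 Q1)) => M; lia.
rewrite mulr0 addr0 mul1r in hD.
apply: eq_cv (cvZ z hD) => M.
by rewrite /T iQ0 subr0 expr1z expr0n !mulr0 addr0 expr0z !mulr1.
Qed.

Lemma base_BP : qpoch_inf (z ^+ 2)^-1 Q != 0 ->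
  BP q z (fun n => qpoch_inf z^-1 Q / qpoch_inf (z ^+ 2)^-1 Q * z^-1 * base_alpha n)
    (fun N => (qpoch (z * Q) Q N)^-1).
Proof.
move=> h1; have [h2 _] := qpochV_inf_cv (nrmQ_lt1 q1) one_sub_zVQ_neq0.
split; first by apply: (gbZ q0 q1); exact: gb_base_alpha.
move=> N; have := HSZ (qpoch_inf z^-1 Q / qpoch_inf (z ^+ 2)^-1 Q * z^-1) (fE N).
have -> : f N = f 0 / qB N by rewrite -(base_const N) mulfK ?qB_neq0.
rewrite base_value /qB.
have -> : qpoch_inf z^-1 Q / qpoch_inf (z ^+ 2)^-1 Q * z^-1 *
   (z * (qpoch_inf (z ^+ 2)^-1 Q / qpoch_inf z^-1 Q) / qpoch (z * Q) Q N)
   = (qpoch (z * Q) Q N)^-1.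
  have := qB_neq0 N; rewrite /qB.
  move: h1 h2; move: (qpoch_inf _ _) (qpoch_inf _ _) (qpoch _ _ _) => a b c a0 b0 c0.
  by field; rewrite a0 b0 c0 z0.
by apply: eq_HS => n; ring.
Qed.

Hypothesis hz : forall j : nat, 1 - (- q / z) * Q ^+ j != 0.

(** * The outermost weight *)
Definition outer_wt (s : int) : R[i] := outer q z s * layer_wt q z s.
Local Notation W := outer_wt.

Lemma gb_outer_wt : gb q absz (fun s => s ^+ 2 + neg2 s) W.
Proof.
apply: (gb_weak q0 q1 (K := 2%N) (gbM q0 (gb_outer q0 q1 z0 hz) (gb_wt q0 q1 z0))).
move=> s _ /=; split; first by lia.
by rewrite /neg2 /pos2; case: ifP => _; lia.
Qed.

Lemma outer_wtS s : W (s + 1) = W s * (z * q * Q ^ s * (1 + z * q * Q ^ s)).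
Proof.
rewrite /W outerS // wtS //.
have -> : q ^ (- (2 * s + 1)) = (Q ^ s * q)^-1.
  by rewrite -invr_expz qzD expr1z QzE.
have := Qpowz_neq0 s; move: (outer _ _ _) (layer_wt _ _ _) (Q ^ s) => a b X X0.
by field; rewrite z0 q0 X0.
Qed.

Section OuterSum.
Variable n : int.
Let y := z * q * Q ^ n.
(** The certificate (1 - y) (1 - Q^(s-n)) W_s k_s(n), again expanded. The recurrence now runs in
    [n], the only parameter left by the sum over [s]. *)
Let H s := (1 - y) * (W s - (Q ^ n)^-1 * (Q ^ s * W s)) * ker s n.

Lemma outer_cert s :
  y * (W s * ker s n) - W s * ker s (n + 1) = H (s + 1) - H s.
Proof.
have e1 : iQ (s - (n + 1)) = iQ (s - n) * (1 - Q ^ (s - n)).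
  by rewrite iQS // (_ : s - (n + 1) + 1 = s - n) //; ring.
have e2 : iQ (s - n) = iQ (s - n + 1) * (1 - Q ^ (s - n + 1)) by rewrite -iQS.
have e3 : iA (s + n) = iA (s + n + 1) * (1 - z ^+ 2 * Q ^ (s + n + 1)) by rewrite -iAS.
have e4 : s + 1 - n = s - n + 1 by ring.
have e5 : s + 1 + n = s + n + 1 by ring.
have e6 : s + (n + 1) = s + n + 1 by ring.
rewrite /H /y /bailey_kernel outer_wtS e4 e5 e6 e1 e2 e3 (QzD (s - n)) (QzD (s +
  n)) !QzB !QzD expr1z.
have := Qpowz_neq0 n.
move: (W s) (iQ _) (iA _) (Q ^ s) (Q ^ n) => w a c X Y Y0.
by field.
Qed.

Lemma outer_summH : summ H.
Proof.
have h : gb q absz (fun s => s ^+ 2 + neg2 s)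
    (fun s => (1 - y) * (W s - (Q ^ n)^-1 * (Q ^ s * W s))).
  apply: (gbZ q0 q1); apply: gbD gb_outer_wt _; apply: (gbN q0 q1); apply: (gbZ q0 q1).
  have g := gbM q0 (gb_powz q id (Qbase_neq0 q0)) gb_outer_wt.
  by apply: (gb_weak q0 q1 (K := 2%N) g) => s _ /=; split; lia.
exact: (summ_weight q0 q1 z0 hzz n h).
Qed.

End OuterSum.

Let e n := projT1 (cid (summ_HS (summ_weight q0 q1 z0 hzz n gb_outer_wt))).
Let eE n : HS (fun s => W s * ker s n) (e n).
Proof. by rewrite /e; case: cid. Qed.

Lemma outer_rec n : e (n + 1) = z * q * Q ^ n * e n.
Proof.
have h := HSB (HSZ (z * q * Q ^ n) (eE n)) (eE (n + 1)).
have h2 := HS_telescope (outer_summH n).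
apply/esym/eqP; rewrite -subr_eq0; apply/eqP; apply: HS_unique h _.
by apply: eq_HS h2 => s; rewrite outer_cert.
Qed.

Lemma outer_const n : e n = e 0 * (q ^ (n ^+ 2) * z ^ n).
Proof.
have h m : q ^ (m ^+ 2) * z ^ m != 0 by rewrite mulf_neq0 // expfz_neq0.
have := @int_constant _ (fun n => e n / (q ^ (n ^+ 2) * z ^ n)) _ n.
rewrite expr0n expr0z mulr1 divr1 => <-; first by rewrite divfK.
move=> m; rewrite outer_rec zzD expr1z.
have -> : q ^ ((m + 1) ^+ 2) = q ^ (m ^+ 2) * (Q ^ m * q).
  have -> : (m + 1) ^+ 2 = m ^+ 2 + (2 * m + 1) by ring.
  by rewrite !qzD expr1z QzE.
have := h m; rewrite mulf_eq0 negb_or => /andP[]; have := Qpowz_neq0 m.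
move: (e m) (q ^ _) (z ^ _) (Q ^ m) => a b c d d0 b0 c0.
by field; rewrite z0 q0 b0 c0 d0.
Qed.

(** Each factor 1 + q^(-(2j+1))/z equals z^(-1) q^(-(2j+1)) (1 + z q Q^j). In this form the
    behaviour as s -> +oo is visible. *)
Lemma outer_nat (s : nat) :
  outer q z s = z ^ (- s%:Z) * q ^ (- s%:Z ^+ 2) * qpoch (- z * q) Q s.
Proof.
elim: s => [|s IH].
  by rewrite outer_pos // (qpochE _ _ 0) !big_ord0 !expr0z !mulr1.
have -> : s.+1%:Z = s%:Z + 1 by lia.
rewrite outerS // IH qpochS //.
have -> : q ^ (- (2 * s%:Z + 1)) = (Q ^ s%:Z * q)^-1.
  by rewrite -invr_expz qzD expr1z QzE.
have -> : q ^ (- (s%:Z + 1) ^+ 2) = q ^ (- s%:Z ^+ 2) / (Q ^ s%:Z * q).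
  have -> : (Q ^ s%:Z * q)^-1 = q ^ (- (2 * s%:Z + 1)).
    by rewrite -invr_expz qzD expr1z QzE.
  by rewrite -qzD; congr (_ ^ _); ring.
have -> : z ^ (- (s%:Z + 1)) = z ^ (- s%:Z) / z by rewrite opprD zzD -[z ^
  -1]invr_expz expr1z.
have := Qpowz_neq0 s%:Z; move: (z ^ _) (q ^ _) (qpoch _ _ _) (Q ^ _) => a b c X X0.
by field; rewrite z0 q0 X0.
Qed.

Let D2 (n : nat) (m : int) : R[i] :=
  qpoch (- z * q) Q (absz (n%:Z + m)) * iA (absz (2 * n%:Z + m)).

Let T2 (n : nat) (m : int) : R[i] :=
  z ^ m * q ^ (m ^+ 2 + 2 * n%:Z * m) * D2 n m * iQ m.

Lemma outer_term (n : nat) m :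
  W (n%:Z + m) * ker (n%:Z + m) n = q ^ (n%:Z ^+ 2) * z ^ n%:Z * T2 n m.
Proof.
rewrite /T2 /D2 /bailey_kernel.
have -> : n%:Z + m - n%:Z = m by ring.
have [m0|m0] := ltP m 0; first by rewrite iQ_neg // !(mulr0, mul0r).
have e2 : n%:Z + m + n%:Z = (absz (2 * n%:Z + m))%:Z by lia.
have e1 : n%:Z + m = (absz (n%:Z + m))%:Z by lia.
rewrite e2 /W /layer_wt {1 2 3}e1 outer_nat.
set s := absz (n%:Z + m); have es : s%:Z = n%:Z + m by rewrite /s; lia.
have -> : z ^ (2 * s%:Z) = z ^ s%:Z * (z ^ n%:Z * z ^ m).
  by rewrite -!zzD; congr (_ ^ _); lia.
have -> : q ^ (2 * s%:Z ^+ 2) = q ^ (s%:Z ^+ 2) * (q ^ (n%:Z ^+ 2) * q ^ (m ^+ 2 +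
  2 * n%:Z * m)).
  by rewrite -!qzD; congr (_ ^ _); rewrite es; ring.
rewrite -[z ^ (- s%:Z)]invr_expz -[q ^ (- s%:Z ^+ 2)]invr_expz.
have := @expfz_neq0 _ _ s%:Z z0; have := @expfz_neq0 _ _ (s%:Z ^+ 2) q0.
move: (z ^ s%:Z) (q ^ (s%:Z ^+ 2)) => a b a0 b0.
by field; rewrite a0 b0.
Qed.

Lemma iA_factor (j : nat) : 1 - z ^+ 2 * Q * Q ^+ j != 0.
Proof. by have := hzz (j%:Z + 1); rewrite QzD expr1z -mulrA [Q * _]mulrC. Qed.

(** Here the constant is read off as n -> +oo: with s = n + m only m >= 0 contributes, and q^(2nm)
    leaves m = 0 alone. *)
Lemma outer_value :
  e 0 = qpoch_inf (- z * q) Q / qpoch_inf (z ^+ 2 * Q) Q.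
Proof.
have Q1 := nrmQ_lt1 q1.
have [C1 h1] := qpoch_bounded (- z * q) Q1; have [C2 h2] := qpochV_bounded Q1 iA_factor.
have hC n m : nrm (D2 n m) <= C1 * C2.
  by rewrite /D2 nrmM; apply: ler_pM; [exact: nrm_ge0|exact: nrm_ge0|exact:
    h1|exact: h2].
apply: (@tannery_zero _ q q0 q1 T2 (fun a => a.2 ^+ 2 + 2 * a.1%:Z * a.2)).
- have hD : gb q (fun=> 0%N) (fun=> 0) (fun a : nat * int => D2 a.1 a.2).
    by apply: (@gb_bounded _ _ _ _ (C1 * C2)) => a; apply: hC.
  have g := gbM q0 (gbM q0 (gbM q0 (gb_powz q (fun a : nat * int => a.2) z0)
    (gb_qpowz q (fun a : nat * int => a.2 ^+ 2 + 2 * a.1%:Z * a.2))) hD)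
    (gb_comp (snd : nat * int -> int) (gb_qpochQV q0 q1)).
  by apply: (gb_weak q0 q1 (K := 1%N) g) => a _ /=; split; lia.
- move=> n m; have [m0|m0 _] := ltP m 0; first by rewrite /T2 iQ_neg // mulr0 eqxx.
  by rewrite /= expr2; nia.
- move=> n; set c := q ^ (n%:Z ^+ 2) * z ^ n%:Z.
  have c0 : c != 0 by rewrite mulf_neq0 // expfz_neq0.
  have -> : e 0 = c^-1 * e n%:Z by rewrite (outer_const n%:Z) -/c mulrCA mulVf ?mulr1.
  have := HS_shift n%:Z (HSZ c^-1 (eE n%:Z)); apply: eq_HS => m /=.
  by rewrite addrC outer_term -/c mulKf.
- by move=> n m m0; rewrite /T2 iQ_neg // mulr0.
- move=> m m0.
  have h3 n : nrm (D2 n m * (z ^ m * q ^ (m ^+ 2) * iQ m))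
     <= C1 * C2 * nrm (z ^ m * q ^ (m ^+ 2) * iQ m).
    by rewrite nrmM ler_wpM2r ?nrm_ge0.
  apply: eq_cv (cvM0 h3 (cv_powz0 q0 q1 m0)) => n.
  by rewrite /T2 (qzD (m ^+ 2)); ring.
have hD : cv \oo (fun n => D2 n 0)
    (qpoch_inf (- z * q) Q * (qpoch_inf (z ^+ 2 * Q) Q)^-1).
  apply: cvM.
    apply: (cv_int (g := fun M : nat => absz (M%:Z + 0)) (k := 0)
     (qpoch_inf_cv (- z * q) Q1)) => M; lia.
  have [_ hA] := qpochV_inf_cv Q1 iA_factor.
  by apply: (cv_int (u := iA) (g := fun M : nat => absz (2 * M%:Z + 0)) (k := 0)
    hA) => M; lia.
apply: eq_cv hD => n.
by rewrite /T2 iQ0 expr0z expr0n mulr0 addr0 expr0z !mul1r mulr1.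
Qed.

Lemma outer_sum n : HS (fun s => W s * ker s n)
  (qpoch_inf (- z * q) Q / qpoch_inf (z ^+ 2 * Q) Q * (q ^ (n ^+ 2) * z ^ n)).
Proof. by rewrite -outer_value -outer_const; exact: eE. Qed.

End BaseAndOuter.

(** * Sums over tuples as iterated sums *)

Section TupleSums.
Variable R : realType.

Lemma HS_tuple_step m (v : int -> R[i]) (ch : int -> seq int -> R[i]) be S :
  (forall s, HS (fun k : m.-tuple int => ch s k) (be s)) ->
  HS (fun s => v s * be s) S ->
  summ (fun p : int * m.-tuple int => v p.1 * ch p.1 p.2) ->
  HS (fun k : m.+1.-tuple int => v (thead k) * ch (thead k) (behead k)) S.
Proof.
move=> hch hv hs; have [S' hS'] := summ_HS hs.
have := HS_fubini (g := fun s => v s * be s) hS' (fun s => HSZ (v s) (hch s)).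
move=> /(HS_unique hv) ->.
apply: eq_HS (HS_reindex_bij (h := fun k : m.+1.-tuple int => (thead k, [tuple of
  behead k]))
  (h' := fun p => [tuple of p.1 :: p.2]) _ _ hS') => //.
- by move=> k; rewrite [RHS]tuple_eta; apply: val_inj.
- by case=> s k; rewrite theadE; congr (_, _); apply: val_inj.
Qed.

Lemma absb_tuple_step m (v : int -> R[i]) (ch : int -> seq int -> R[i])
    (b : int -> R) B :
  (forall s, absb (fun k : m.-tuple int => nrm (ch s k)) (b s)) ->
  absb (fun s => nrm (v s) * b s) B ->
  absb (fun p : int * m.-tuple int => nrm (v p.1 * ch p.1 p.2)) B.
Proof.
move=> hch; apply: absb_prod => [p|s]; first exact: nrm_ge0.
apply: absb_le (absbZ (nrm_ge0 (v s)) (hch s)) => k.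
by rewrite nrmM.
Qed.

End TupleSums.

(** * The difference form of the Bailey pairs, level by level *)

Section MultiSum.
Variables (R : realType) (q z : R[i]).
Hypotheses (q0 : q != 0) (q1 : nrm q < 1) (z0 : z != 0).
Local Notation Q := (q ^+ 2).
Local Notation rho := (nrm q).
Hypothesis hzz : forall n : int, 1 - z ^+ 2 * Q ^ n != 0.
Local Notation iQ := (inv_qfact q).
Local Notation wt := (layer_wt q z).
Local Notation qzD := (qzD q0).
Local Notation QzD := (QzD q0).
Local Notation QzB := (QzB q0).
Local Notation Qpowz_neq0 := (Qpowz_neq0 q0).
Local Notation zzD := (zzD z0).

Definition base_factor : R[i] := qpoch_inf z^-1 Q / qpoch_inf (z ^+ 2)^-1 Q.

(** The families g_n of the difference form: up to a constant, [Q ^ n * penta q z n] belongs to the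
    initial pair, and each layer with a linear exponent contributes [wt n * Q ^ n]. *)
Definition level_gamma (m : nat) (n : int) : R[i] :=
  base_factor * (Q ^ n * penta q z n) * (wt n * Q ^ n) ^+ m.
Local Notation gam := level_gamma.

Definition level_diff (m : nat) (n : int) : R[i] :=
  gam m n - z ^+ 2 * Q ^ (2 * n - 1) * gam m (n - 1).
Local Notation bdiff := level_diff.

Lemma wt_pred n : wt n = z ^+ 2 * Q ^ (2 * n - 1) * wt (n - 1).
Proof.
rewrite -[in LHS](subrK 1 n) wtS //.
have -> : 2 * n - 1 = (n - 1) + (n - 1) + 1 by ring.
rewrite !(QzD _ 1) !(QzD (n - 1)) expr1z; move: (Q ^ (n - 1)) (wt _) => X w; ring.
Qed.

Lemma gb_gam m : gb q absz (fun n => 3 * n ^+ 2) (gam m).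
Proof.
elim: m => [|m IH].
  apply: (eq_gb (f := fun n => base_factor * (Q ^ n * penta q z n))).
    by move=> n; rewrite /gam expr0 mulr1.
  apply: (gbZ q0 q1); apply: (gb_linear q0 q1 (K := 1%N)) (gb_penta q0 q1 z0).
    exact: Qbase_neq0.
  by move=> n; lia.
have g := gbM q0 (gb_wt q0 q1 z0) (gb_linear q0 q1 (K := 1%N) (k := id) (Qbase_neq0 q0)
  (fun n => ltac:(lia)) IH).
apply: (eq_gb (f := fun n => wt n * (Q ^ n * gam m n))).
  by move=> n; rewrite /gam (exprS (wt n * Q ^ n)); ring.
apply: (gb_weak q0 q1 (K := 2%N) g) => n _ /=; split; first by lia.
by have := sqr_ge0 n; lia.
Qed.

(** By [pentaS], z^(-1) penta_n = -z^2 Q^(2n-1) Q^(n-1) penta_(n-1), so the two summands of 1 + z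
    Q^n are the two halves of the difference. *)
Lemma base_bdiff n : base_factor * z^-1 * base_alpha q z n = bdiff 0 n.
Proof.
rewrite /bdiff /gam !expr0 !mulr1 /base_alpha.
have -> : penta q z n = penta q z (n - 1) * (- z ^+ 3 * (Q ^ n / Q) ^+ 3 * Q).
  by rewrite -[in LHS](subrK 1 n) pentaS // QzB expr1z.
have -> : Q ^ (2 * n - 1) = Q ^ n * Q ^ n / Q.
  by rewrite mulr_natl mulr2n QzB QzD expr1z.
rewrite QzB expr1z; have := Qpowz_neq0 n.
move: base_factor (penta _ _ _) (Q ^ n) => D u X X0.
by field; rewrite z0 q0.
Qed.

Lemma bdiff_step m n :
  wt n * (Q ^ n * gam m n - Q ^ (n - 1) * gam m (n - 1)) = bdiff m.+1 n.
Proof.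
rewrite /bdiff.
have gS k : gam m.+1 k = wt k * (Q ^ k * gam m k).
  by rewrite /gam (exprS (wt k * Q ^ k)); ring.
rewrite !gS.
have -> : z ^+ 2 * Q ^ (2 * n - 1) * (wt (n - 1) * (Q ^ (n - 1) * gam m (n - 1)))
  = wt n * (Q ^ (n - 1) * gam m (n - 1)) by rewrite [in RHS]wt_pred; ring.
by ring.
Qed.

Variables i r : nat.

Definition lin (j : nat) (s : int) : R[i] := if (i <= j)%N then Q ^ s else 1.

(** * The multiple sum *)
(* [chain j N k] is the product of the factors attached to [k_j, k_(j+1), ...],
   where [k_(j-1) = N]. *)
Fixpoint chain (j : nat) (N : int) (k : seq int) : R[i] :=
  if k is s :: k' then wt s * lin j s * iQ (N - s) * chain j.+1 s k'
  else (qpoch (z * Q) Q N)^-1.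

Lemma gb_lin j : gb q absz (fun=> 0) (lin j).
Proof.
rewrite /lin; case: leqP => _; first exact: (gb_powz q id (Qbase_neq0 q0)).
by apply: (gb_weak q0 q1 (K := 1%N) (gb_cst q _ 1)) => s _ /=; split; lia.
Qed.

(** The bound has the shape of that for 1 / (zQ; Q)_N, the chain of length 0; the loss [neg2 N] is
    what the weight of the next layer can pay for. *)
Definition chain_bounded (m j : nat) := exists C M : R, [/\ 0 <= C, 1 <= M &
  forall N, absb (fun k : m.-tuple int => nrm (chain j N k))
    (C * M ^+ absz N * rho ^ (- neg2 N))].

Lemma weighted_bounded (v : int -> R[i]) (C M : R) : 0 <= C -> 1 <= M ->
  gb q absz (fun s => s ^+ 2 + neg2 s) v ->
  exists B, absb (fun s => nrm (v s) * (C * M ^+ absz s * rho ^ (- neg2 s))) B.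
Proof.
move=> C0 M1 hv.
pose w s := real_complex R (C * M ^+ absz s * rho ^ (- neg2 s)).
have wE s : nrm (w s) = C * M ^+ absz s * rho ^ (- neg2 s).
  rewrite nrmC ger0_norm // !mulr_ge0 ?exprn_ge0 ?exprz_ge0 ?nrm_ge0 //.
  by apply: le_trans M1.
have hw : gb q absz (fun s => - neg2 s) w.
  by exists C, M; split=> // s; rewrite wE.
have g : gb q absz (fun s => s ^+ 2) (fun s => v s * w s).
  by apply: (gb_weak q0 q1 (K := 2%N) (gbM q0 hv hw)) => s _ /=; split; lia.
have [s _|B hB] := summ_gb q0 q1 g; first by have := sqr_ge0 s; lia.
by exists B; apply: absb_le hB => s; rewrite nrmM wE.
Qed.

Lemma gb_layer_wt j : gb q absz (fun s => s ^+ 2 + neg2 s) (fun s => wt s * lin j s).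
Proof.
apply: (gb_weak q0 q1 (K := 2%N) (gbM q0 (gb_wt q0 q1 z0) (gb_lin j))) => s _ /=.
by split; [lia|have := neg2_le s; lia].
Qed.

Lemma chain_bounded0 j : chain_bounded 0 j.
Proof.
have hB (j' : nat) : 1 - z * Q * Q ^+ j' != 0 by apply: (qB_factor q0 hzz j').
have [C [M [C0 M1 h]]] := gb_qpochV q0 q1 hB.
exists C, M; split=> // N F; apply: le_trans (h N).
have sF : F `<=` [fset [tuple]].
  by apply/fsubsetP => t _; rewrite tuple0 inE.
apply: le_trans (ler_sum_fset _ sF) _ => [t|]; first exact: nrm_ge0.
by rewrite big_seq_fset1.
Qed.

Lemma chain_boundedS m j : chain_bounded m j.+1 ->
  (forall N, summ (fun p : int * m.-tuple int =>
     wt p.1 * lin j p.1 * iQ (N - p.1) * chain j.+1 p.1 p.2)) /\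
  chain_bounded m.+1 j.
Proof.
move=> [C [M [C0 M1 h]]].
have [B hB] := weighted_bounded C0 M1 (gb_layer_wt j).
have [Cq [Mq [Cq0 Mq1 hq]]] := gb_qpochQV q0 q1.
have M0 : 0 <= M by apply: le_trans M1.
have hN N : absb (fun p : int * m.-tuple int =>
    nrm (wt p.1 * lin j p.1 * iQ (N - p.1) * chain j.+1 p.1 p.2)) (Cq * B).
  apply: (absb_tuple_step (v := fun s => wt s * lin j s * iQ (N - s)) h).
  apply: absb_le (absbZ Cq0 hB) => s.
  have := hq (N - s); rewrite expr0 expr0z !mulr1 => hs.
  rewrite [leRHS]mulrA ler_wpM2r ?mulr_ge0 ?exprn_ge0 ?exprz_ge0 ?nrm_ge0 //.
  by rewrite nrmM mulrC ler_wpM2r ?nrm_ge0.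
split=> [N|]; first by exists (Cq * B).
(* The bound [Cq * B] is uniform in [N] because [iQ] is bounded; the factor [rho ^ (- neg2 N) >= 1]
   only restores the required shape. *)
exists (Cq * B), 1; split=> // [|N F]; first by apply: absb_ge0 (hN 0).
apply: (@le_trans _ _ (Cq * B)).
  apply: le_trans (hN N [fset (thead k, [tuple of behead k]) | k in F]).
  rewrite big_imfset /=; last first.
    move=> a b _ _ [e1 e2]; rewrite (tuple_eta a) (tuple_eta b) e1.
    by apply: val_inj; rewrite /= e2.
  by apply: ler_sum => k _; rewrite {1}(tuple_eta k).
rewrite expr1n mulr1 ler_peMr ?(absb_ge0 (hN 0)) //.
by rewrite -[leLHS](expr0z rho) rho_le // oppr_le0 /neg2; case: ifP => // _; exact:
  sqr_ge0.
Qed.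

Lemma chain_bounded_all m j : chain_bounded m j.
Proof.
elim: m j => [|m IH] j; first exact: chain_bounded0.
by have [] := chain_boundedS (IH j.+1).
Qed.

(* [i - j] is truncated: for [j >= i] every layer so far carries a linear
   exponent, and these are recorded in [bdiff]. *)
Definition level_alpha (j : nat) (n : int) : R[i] :=
  wt n ^+ (i - j) * bdiff (r - maxn i j) n.

Hypothesis hinf : qpoch_inf (z ^+ 2)^-1 Q != 0.

(** Induction from the innermost index outwards. A layer j >= i is preceded by [BP_shift], which
    absorbs Q^(k_j); a layer j < i only multiplies by [wt n]. *)
Lemma chain_sum m : (m < r)%N -> (i <= r)%N -> exists be,
  (forall N, HS (fun k : m.-tuple int => chain (r - m) N k) (be N)) /\
  BP q z (level_alpha (r - m)) be.
Proof.
move=> mr ir; elim: m mr => [|m IH] mr.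
  exists (fun N => (qpoch (z * Q) Q N)^-1); split=> [N|].
    have := @HS_single R _ (fun k : 0.-tuple int => chain (r - 0) N k) [tuple].
    by apply=> t; rewrite tuple0 eqxx.
  have [h1 h2] := base_BP q0 q1 z0 hzz hinf.
  have e n : base_factor * z^-1 * base_alpha q z n = level_alpha (r - 0) n.
    rewrite /level_alpha subn0 (eqP ir : i - r = 0)%N mul1r base_bdiff.
    by rewrite (maxn_idPr ir) subnn.
  split=> [|N]; first exact: eq_gb e h1.
  by apply: eq_HS (h2 N) => n; rewrite -e.
have [be [hbe hBP]] := IH (ltnW mr).
have ej : (r - m = (r - m.+1).+1)%N by lia.
set j := (r - m.+1)%N in ej *; rewrite ej in hbe hBP.
have [be' [h1 h2]] : exists be',
    (forall N, HS (fun s => wt s * lin j s * iQ (N - s) * be s) (be' N)) /\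
    BP q z (level_alpha j) be'.
  have [ij|ji] := leqP i j.
    have hs : BP q z (fun n => gam m n - z ^+ 2 * Q ^ (2 * n - 1) * gam m (n - 1)) be.
      have e n : level_alpha j.+1 n = bdiff m n.
        rewrite /level_alpha (_ : i - j.+1 = 0)%N ?mul1r; last by lia.
        by congr bdiff; rewrite /j; lia.
      split; first by apply: eq_gb hBP.1.
      by move=> N; apply: eq_HS (hBP.2 N) => n; rewrite e.
    have [be' [h1 [h2 h3]]] := BP_layer q0 q1 z0 hzz (BP_shift q0 q1 z0 hzz (gb_gam
      m) hs).
    have e n : wt n * (Q ^ n * gam m n - Q ^ (n - 1) * gam m (n - 1)) = level_alpha j n.
      rewrite bdiff_step /level_alpha (_ : i - j = 0)%N ?mul1r; last by lia.
      by congr bdiff; rewrite /j; lia.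
    exists be'; split=> [N|].
      by apply: eq_HS (h1 N) => s; rewrite /lin ij; ring.
    split; first by apply: eq_gb h2.
    by move=> N; apply: eq_HS (h3 N) => n; rewrite e.
  have [be' [h1 [h2 h3]]] := BP_layer q0 q1 z0 hzz hBP.
  have e n : wt n * level_alpha j.+1 n = level_alpha j n.
    rewrite /level_alpha mulrA -exprS (_ : (i - j.+1).+1 = i - j)%N; last by lia.
    by congr (_ * bdiff _ _); lia.
  exists be'; split=> [N|].
    by apply: eq_HS (h1 N) => s; rewrite /lin leqNgt ji /= mulr1.
  split; first by apply: eq_gb h2.
  by move=> N; apply: eq_HS (h3 N) => n; rewrite e.
exists be'; split=> // N.
have [hs _] := chain_boundedS (chain_bounded_all m j.+1).
apply: eq_HS (HS_tuple_step (v := fun s => wt s * lin j s * iQ (N - s)) hbe (h1 N)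
  (hs N)).
by move=> k; case/tupleP: k => s k'; rewrite theadE.
Qed.

End MultiSum.

(** * Comparison with the theta series and with the closed summand *)

Section Assembly.
Variables (R : realType) (q z : R[i]).
Hypotheses (q0 : q != 0) (q1 : nrm q < 1) (z0 : z != 0).
Local Notation Q := (q ^+ 2).
Hypothesis hzz : forall n : int, 1 - z ^+ 2 * Q ^ n != 0.
Hypothesis hinf : qpoch_inf (z ^+ 2)^-1 Q != 0.
Hypothesis hz : forall j : nat, 1 - (- q / z) * Q ^+ j != 0.
Local Notation iQ := (inv_qfact q).
Local Notation wt := (layer_wt q z).
Local Notation W := (outer_wt q z).
Local Notation gam := (level_gamma q z).
Local Notation bdiff := (level_diff q z).
Local Notation D := (base_factor q z).

(** Once all factors are monomials, the comparison with the theta series reduces to polynomial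
    identities between integer exponents. *)
Let mon (a b : int) : R[i] := z ^ a * q ^ b.

Lemma monM a b c d : mon a b * mon c d = mon (a + c) (b + d).
Proof. by rewrite /mon !expfzDr //; ring. Qed.

Lemma mon_eq a b c d : a = c -> b = d -> mon a b = mon c d.
Proof. by move=> -> ->. Qed.

Lemma monXz a b n : mon a b ^ n = mon (a * n) (b * n).
Proof. by rewrite /mon expfzMl !exprz_exp. Qed.

Lemma wt_mon n : wt n = mon (2 * n) (2 * n ^+ 2). Proof. by []. Qed.

Lemma signN (n : int) : (-1 : R[i]) ^ (n - 1) = - (-1) ^ n.
Proof.
rewrite expfzDr ?oppr_eq0 ?oner_eq0 // -[(-1) ^ (-1)]invr_expz expr1z invrN1.
by rewrite mulrN1.
Qed.

Lemma gam_mon m n : gam m n = D * ((-1) ^ n *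
  mon (3 * n + 2 * n * m%:Z) (3 * n ^+ 2 + n + (2 * n ^+ 2 + 2 * n) * m%:Z)).
Proof.
rewrite /level_gamma /penta.
have -> : (wt n * Q ^ n) ^+ m = mon (2 * n * m%:Z) ((2 * n ^+ 2 + 2 * n) * m%:Z).
  have -> : wt n * Q ^ n = mon (2 * n) (2 * n ^+ 2 + 2 * n).
    by rewrite /layer_wt QzE /mon (qzD q0) mulrA.
  by rewrite exprnP monXz.
have -> : - z ^+ 3 = (-1) * z ^ (3 : int) by rewrite mulN1r.
rewrite (expfzMl (-1)) exprz_exp.
have -> : Q ^ n * ((-1) ^ n * z ^ (3 * n) * q ^ (3 * n ^+ 2 - n))
   = (-1) ^ n * mon (3 * n) (3 * n ^+ 2 + n).
  rewrite /mon QzE (_ : 3 * n ^+ 2 + n = 2 * n + (3 * n ^+ 2 - n)); last by ring.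
  by rewrite (qzD q0 (2 * n)); ring.
by rewrite -monM; ring.
Qed.

(** The summand of the triple product with p = q^(2r) and x = z^(2r) q^c. *)
Definition theta_term (r : nat) (c : int) (n : int) : R[i] :=
  (- (z ^+ (2 * r) * q ^ c)) ^ n * (q ^+ (2 * r)) ^ (n ^+ 2 - n).

Lemma theta_mon r c n : theta_term r c n =
  (-1) ^ n * mon (2 * r%:Z * n) (c * n + 2 * r%:Z * (n ^+ 2 - n)).
Proof.
rewrite /theta_term -(mulN1r (z ^+ (2 * r) * q ^ c)) (expfzMl (-1)).
have -> : z ^+ (2 * r) * q ^ c = mon (2 * r%:Z) c by [].
have -> : (q ^+ (2 * r)) ^ (n ^+ 2 - n) = mon 0 (2 * r%:Z * (n ^+ 2 - n)).
  by rewrite /mon expr0z mul1r (exprnP q) exprz_exp PoszM.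
have -> : mon (2 * r%:Z * n) (c * n + 2 * r%:Z * (n ^+ 2 - n))
  = mon (2 * r%:Z * n) (c * n) * mon 0 (2 * r%:Z * (n ^+ 2 - n)).
  by rewrite monM addr0.
by rewrite monXz; ring.
Qed.

Definition theta_pair (r i : nat) (n : int) : R[i] :=
  theta_term r (4 * r%:Z + 1 - 2 * i%:Z) n
  + z ^ (2 * i%:Z - 1 - 2 * r%:Z) * theta_term r (2 * i%:Z - 1) n.

Lemma zpow_mon a : z ^ a = mon a 0.
Proof. by rewrite /mon expr0z mulr1. Qed.

Lemma Qpow_mon a : Q ^ a = mon 0 (2 * a).
Proof. by rewrite /mon expr0z mul1r QzE. Qed.

(** The two halves of the difference give the two theta terms at the same [n]; (-1)^(n-1) = -(-1)^n
    turns the sign of the second. Writing i = a + 2 and r = m + a + 2 avoids truncated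
    subtraction. *)
Lemma final_term (m a : nat) n :
  level_alpha q z a.+2 (m + a.+2) 2 n * (q ^ (n ^+ 2) * z ^ n)
  = D * theta_pair (m + a.+2) a.+2 n.
Proof.
rewrite (_ : q ^ (n ^+ 2) * z ^ n = mon n (n ^+ 2)); last by rewrite mulrC.
have e1 : (a.+2 - 2 = a)%N by rewrite !subSS subn0.
have e2 : maxn a.+2 2 = a.+2 by apply/maxn_idPl.
rewrite /level_alpha e1 e2 addnK /level_diff !gam_mon signN.
rewrite /theta_pair !theta_mon zpow_mon Qpow_mon wt_mon exprnP monXz.
rewrite (_ : z ^+ 2 = mon 2 0); last by rewrite /mon expr0z mulr1.
have -> : (m + a.+2)%N%:Z = m%:Z + a%:Z + 2 by lia.
have -> : a.+2%:Z = a%:Z + 2 by lia.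
set s := (-1) ^ n.
have -> : forall A B C E F : R[i], A * (D * (s * B) - C * (D * (- s * E))) * F
  = D * (s * (A * B * F) + s * (A * C * E * F)) by move=> *; ring.
congr (_ * (_ + _)).
  by rewrite !monM; congr (s * _); apply: mon_eq; ring.
by rewrite [RHS]mulrCA !monM; congr (s * _); apply: mon_eq; ring.
Qed.

(** For i = 1 the outermost index carries a linear exponent too, so the last pair is shifted once
    more, without a further layer. *)
Lemma final_term1 (m : nat) n :
  (Q ^ n * gam m n - Q ^ (n - 1) * gam m (n - 1)) * (q ^ (n ^+ 2) * z ^ n)
  = D * theta_pair m.+2 1 n.
Proof.
rewrite (_ : q ^ (n ^+ 2) * z ^ n = mon n (n ^+ 2)); last by rewrite mulrC.
rewrite !gam_mon signN /theta_pair !theta_mon zpow_mon !Qpow_mon.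
set s := (-1) ^ n.
have -> : forall A B C E F : R[i], (A * (D * (s * B)) - C * (D * (- s * E))) * F
  = D * (s * (A * B * F) + s * (C * E * F)) by move=> *; ring.
have -> : m.+2%:Z = m%:Z + 2 by lia.
congr (_ * (_ + _)).
  rewrite !monM; congr (s * _); apply: mon_eq; ring.
by rewrite [RHS]mulrCA !monM; congr (s * _); apply: mon_eq; ring.
Qed.

(** With P = q^(4r), the condition [c + c' = 4 * r%:Z] makes the argument of the last product equal
    to P / x. *)
Lemma theta_sum (r : nat) (c c' : int) : (0 < r)%N -> c + c' = 4 * r%:Z ->
  HS (theta_term r c) (qpoch_inf (q ^+ (4 * r)) (q ^+ (4 * r)) *
    (qpoch_inf (z ^+ (2 * r) * q ^ c) (q ^+ (4 * r)) *
     qpoch_inf (z ^- (2 * r) * q ^ c') (q ^+ (4 * r)))).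
Proof.
move=> r0 hc; set p := q ^+ (2 * r); set x := z ^+ (2 * r) * q ^ c.
have p0 : p != 0 by rewrite expf_neq0.
have p1 : nrm p < 1 by rewrite nrmX exprn_ilt1 ?nrm_ge0 // muln_eq0 /= -lt0n.
have x0 : x != 0 by rewrite mulf_neq0 ?expf_neq0 ?expfz_neq0.
have eP : q ^+ (4 * r) = p ^+ 2 by rewrite -exprM; congr (_ ^+ _); lia.
have ex : z ^- (2 * r) * q ^ c' = p ^+ 2 / x.
  rewrite -eP (exprnP q (4 * r)) (_ : (4 * r)%N%:Z = c + c'); last by lia.
  rewrite expfzDr // /x invfM.
  have := @expf_neq0 _ _ (2 * r) z0; have := @expfz_neq0 _ _ c q0.
  by move: (z ^+ _) (q ^ c) => A B A0 B0; field; rewrite A0 B0.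
by rewrite ex eP; apply: jacobi_triple_product.
Qed.

Local Notation E := (qpoch_inf (- z * q) Q / qpoch_inf (z ^+ 2 * Q) Q).

Definition theta_value (r i : nat) : R[i] :=
  qpoch_inf (q ^+ (4 * r)) (q ^+ (4 * r)) *
  (qpoch_inf2 (z ^+ (2 * r) * q ^ (4 * r%:Z + 1 - 2 * i%:Z))
     (z ^- (2 * r) * q ^ (2 * i%:Z - 1)) (q ^+ (4 * r))
   + z ^ (2 * i%:Z - 1 - 2 * r%:Z)
     * qpoch_inf2 (z ^+ (2 * r) * q ^ (2 * i%:Z - 1))
         (z ^- (2 * r) * q ^ (4 * r%:Z + 1 - 2 * i%:Z)) (q ^+ (4 * r))).

Lemma theta_pair_sum r i : (0 < r)%N -> HS (theta_pair r i) (theta_value r i).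
Proof.
move=> r0; rewrite /theta_value mulrDr [X in _ + X]mulrCA; apply: HSD; last apply: HSZ.
  by apply: theta_sum => //; ring.
by apply: theta_sum => //; ring.
Qed.

Lemma full_sum (m i : nat) : (1 <= i <= m.+2)%N ->
  HS (fun k : m.+1.-tuple int => W (thead k) * lin q i 1 (thead k)
        * chain q z i 2 (thead k) (behead k))
     (E * D * theta_value m.+2 i).
Proof.
move=> /andP[i1 ir].
have [|//|be] := @chain_sum R q z q0 q1 z0 hzz i m.+2 hinf m; first by [].
rewrite (_ : m.+2 - m = 2)%N; last by lia.
move=> [hbe hBP].
have gv : gb q absz (fun s => s ^+ 2 + neg2 s) (fun s => W s * lin q i 1 s).
  apply: (gb_weak q0 q1 (K := 2%N) (gbM q0 (gb_outer_wt q0 q1 z0 hz) (gb_lin q0 q1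
    z0 i 1))).
  by move=> s _ /=; split; lia.
have hsum : summ (fun p : int * m.-tuple int =>
    W p.1 * lin q i 1 p.1 * chain q z i 2 p.1 p.2).
  have [C [M [C0 M1 h]]] := chain_bounded_all q0 q1 z0 hzz i m 2%N.
  have [B hB] := weighted_bounded q0 q1 z0 C0 M1 gv.
  by exists B; apply: (absb_tuple_step (v := fun s => W s * lin q i 1 s) h hB).
apply: (HS_tuple_step (v := fun s => W s * lin q i 1 s) hbe) => //.
have hth := HSZ (E * D) (theta_pair_sum i (isT : 0 < m.+2)%N).
have gW := gb_outer_wt q0 q1 z0 hz.
have hW := outer_sum q0 q1 z0 hzz hz.
have [i2|i2] := leqP 2 i.
  have [S [h1 h2]] := BP_exchange q0 q1 z0 hzz hBP gW hW.
  have -> : E * D * theta_value m.+2 i = S.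
    apply: HS_unique hth _; apply: eq_HS h2 => n.
    have ea : i = (i - 2).+2 by lia.
    have em : m.+2 = (m.+2 - i + (i - 2).+2)%N by lia.
    by rewrite mulrCA [in LHS]ea [in LHS]em final_term -em -ea; ring.
  by apply: eq_HS h1 => s; rewrite /lin leqNgt i2 /= mulr1.
have ei : i = 1%N by lia.
have hBP' : BP q z (fun n => gam m n - z ^+ 2 * Q ^ (2 * n - 1) * gam m (n - 1)) be.
  have e n : level_alpha q z i m.+2 2 n = bdiff m n.
    rewrite /level_alpha ei mul1r; congr (level_diff _ _ _ _); lia.
  split; first by apply: eq_gb hBP.1.
  by move=> N; apply: eq_HS (hBP.2 N) => n; rewrite e.
have hBP2 := BP_shift q0 q1 z0 hzz (gb_gam q0 q1 z0 m) hBP'.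
have [S [h1 h2]] := BP_exchange q0 q1 z0 hzz hBP2 gW hW.
have -> : E * D * theta_value m.+2 i = S.
  apply: HS_unique hth _; apply: eq_HS h2 => n.
  by rewrite mulrCA final_term1 ei; ring.
by apply: eq_HS h1 => s; rewrite /lin ei mulrA.
Qed.

(** 1 / (Q; Q)_(N-s) is 0 for s > N, so the chain vanishes off the nonincreasing tuples and a sum
    over all tuples is a sum over [Lambda]. *)
Lemma chain_path i j N k : chain q z i j N k != 0 -> path >=%R N k.
Proof.
elim: k j N => //= s k IH j N; rewrite !mulf_eq0 !negb_or.
move=> /andP[/andP[_ hN] /IH ->]; rewrite andbT.
by rewrite leNgt; apply: contra hN => Ns; rewrite iQ_neg // subr_lt0.
Qed.

Lemma chain_closed i j N k : chain q z i j N k =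
  z ^ (2 * \sum_(l < size k) k`_l)
  * q ^ (2 * (\sum_(l < size k) k`_l ^+ 2)
         + 2 * (\sum_(l < size k) if (i <= j + l)%N then k`_l else 0))
  / (qpoch (z * Q) Q (last N k)
     * \prod_(l < size k) qpoch Q Q ((N :: k)`_l - k`_l)).
Proof.
elim: k j N => [|s k IH] j N.
  by rewrite /= !big_ord0 !mulr0 addr0 !expr0z !mul1r mulr1.
rewrite /= IH !big_ord_recl /= addn0.
have -> : \sum_(l < size k) (if (i <= j.+1 + l)%N then k`_l else 0)
   = \sum_(l < size k) (if (i <= j + bump 0 l)%N then k`_l else 0).
  by apply: eq_bigr => l _; rewrite /bump /= add1n addnS addSn.
have -> : lin q i j s = q ^ (2 * (if (i <= j)%N then s else 0)).
  by rewrite /lin; case: ifP => _; rewrite ?mulr0 ?expr0z // QzE.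
rewrite /layer_wt /inv_qfact !mulrDr !(zzD z0) !(qzD q0) !invfM.
move: (\sum_(l < size k) _) (\sum_(l < size k) _) (\sum_(l < size k) _) => a b c.
by move: (\prod_(l < size k) _)^-1 (qpoch _ _ _)^-1 (qpoch _ _ _)^-1 => *; ring.
Qed.

End Assembly.

(** * Nonvanishing extracted from the hypotheses, and the theorem *)

Lemma one_sub_z2Qz_neq0 (R : realType) (q z : R[i]) : q != 0 -> nrm q < 1 ->
  z != 0 -> qpoch_inf (z ^+ 2 * q ^+ 2) (q ^+ 2) != 0 ->
  qpoch_inf (z ^+ 2)^-1 (q ^+ 2) != 0 ->
  forall n : int, 1 - z ^+ 2 * (q ^+ 2) ^ n != 0.
Proof.
move=> q0 q1 z0 hA hinf n; have Q1 := nrmQ_lt1 q1.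
have [n0|n0] := ltP 0 n.
  have := qpoch_inf_factor (absz n).-1 Q1 hA; rewrite -mulrA -exprS.
  by rewrite (exprnP (q ^+ 2)) (_ : (absz n).-1.+1%:Z = n) //; lia.
(* For n <= 0, z^2 Q^n = 1 would make the factor 1 - z^(-2) Q^|n| of (1/z^2; Q)_oo vanish. *)
have := qpoch_inf_factor (absz n) Q1 hinf; apply: contra_neq => h.
have e : z ^+ 2 * (q ^+ 2) ^ n = 1 by apply/esym/eqP; rewrite -subr_eq0 h.
have -> : (q ^+ 2) ^+ absz n = ((q ^+ 2) ^ n)^-1.
  by rewrite invr_expz (exprnP (q ^+ 2)); congr (_ ^ _); lia.
by rewrite -invfM e invr1 subrr.
Qed.

(** The constant tuple with entries -(j+1) is nonincreasing, and the first reciprocal in its outer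
    symbol is that of 1 + q^(2j+1)/z. *)
Lemma outer_factor_neq0 (R : realType) (q z : R[i]) (m j : nat) :
  q != 0 -> z != 0 ->
  (forall k : Lambda m.+1,
    qpoch_wd (- q ^ (1 - 2 * part k 1) / z) (q ^+ 2) (part k 1)) ->
  1 - (- q / z) * q ^+ 2 ^+ j != 0.
Proof.
move=> q0 z0 hwd.
have sk : sorted >=%R (nseq_tuple m.+1 (- j.+1%:Z)).
  by rewrite /=; elim: m {hwd} => //= m ->; rewrite lexx.
have := hwd (exist (fun k : m.+1.-tuple int => sorted >=%R k) _ sk) 1%N isT.
rewrite /part /= => /(_ isT).
have -> : 1 - 2 * - j.+1%:Z = 1 + (2 * j)%N%:Z + 2 by lia.
rewrite !(qzD q0) !expr1z -(exprnP q (2 * j)) -exprM expr1; congr (1 - _ != 0);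
  move: (q ^+ (2 * j)) => X.
by field; rewrite q0 z0.
Qed.

Lemma summand_chain (R : realType) (q z : R[i]) (i : nat) (s : int) (k : seq int) :
  q != 0 -> z != 0 -> (1 <= i)%N ->
  outer q z s
  * q ^ (2 * (\sum_(1 <= j < (size k).+2) (s :: k)`_j.-1 ^+ 2)
         + 2 * (\sum_(i <= j < (size k).+2) (s :: k)`_j.-1))
  / (qpoch (z * q ^+ 2) (q ^+ 2) (s :: k)`_(size k)
     * \prod_(1 <= j < (size k).+1)
         qpoch (q ^+ 2) (q ^+ 2) ((s :: k)`_j.-1 - (s :: k)`_j))
  * z ^ (2 * (\sum_(1 <= j < (size k).+2) (s :: k)`_j.-1))
  = outer_wt q z s * lin q i 1 s * chain q z i 2 s k.
Proof.
move=> q0 z0 i1; rewrite chain_closed // (nth_last 0 (s :: k) : (s :: k)`_(size k)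
  = _) /=.
rewrite (big_nat_widenl _ _ _ _ _ i1) [X in 2 * _ + 2 * X]big_mkcond /= !big_add1 /=.
rewrite !big_mkord !big_ord_recl /= /outer_wt /layer_wt.
have -> : lin q i 1 s = q ^ (2 * (if (i <= 1)%N then s else 0)).
  by rewrite /lin; case: ifP => _; rewrite ?mulr0 ?expr0z // QzE.
have -> : \sum_(l < size k) (if (i <= (bump 0 l).+1)%N then k`_l else 0)
   = \sum_(l < size k) (if (i <= 2 + l)%N then k`_l else 0) by [].
rewrite !mulrDr !(zzD z0) !(qzD q0) !invfM.
move: (\sum_(l < size k) _) (\sum_(l < size k) _) (\sum_(l < size k) _) => a b c.
by move: (\prod_(l < size k) _)^-1 (qpoch _ _ _)^-1 => *; ring.
Qed.

Theorem theorem4p8 (R : realType) (r i : nat) (q z : R[i])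
  (hr : (2 <= r)%N) (hi : (1 <= i <= r)%N)
  (hq : `|q| < 1) (hq0 : q != 0) (hz : z != 0)
  (hwd1 : forall k : Lambda r.-1,
    qpoch_wd (- q ^ (1 - 2 * part k 1) / z) (q ^+ 2) (part k 1))
  (hwd2 : forall k : Lambda r.-1,
    qpoch_wd (z * q ^+ 2) (q ^+ 2) (part k r.-1))
  (hdenl : forall k : Lambda r.-1,
    qpoch (z * q ^+ 2) (q ^+ 2) (part k r.-1)
    * \prod_(1 <= j < r.-1)
        qpoch (q ^+ 2) (q ^+ 2) (part k j - part k j.+1) != 0)
  (hdenr : qpoch_inf2 (z ^+ 2 * q ^+ 2) (1 / z ^+ 2) (q ^+ 2) != 0) :
  has_sum
    (fun k : Lambda r.-1 =>
       qpoch (- q ^ (1 - 2 * part k 1) / z) (q ^+ 2) (part k 1)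
       * q ^ (2 * (\sum_(1 <= j < r) part k j ^+ 2)
              + 2 * (\sum_(i <= j < r) part k j))
       / (qpoch (z * q ^+ 2) (q ^+ 2) (part k r.-1)
          * \prod_(1 <= j < r.-1)
              qpoch (q ^+ 2) (q ^+ 2) (part k j - part k j.+1))
       * z ^ (2 * (\sum_(1 <= j < r) part k j)))
    (qpoch_inf2 (- z * q) (1 / z) (q ^+ 2)
     / qpoch_inf2 (z ^+ 2 * q ^+ 2) (1 / z ^+ 2) (q ^+ 2)
     * qpoch_inf (q ^+ (4 * r)) (q ^+ (4 * r))
     * (qpoch_inf2 (z ^+ (2 * r) * q ^ (4 * r%:Z + 1 - 2 * i%:Z))
                   (z ^- (2 * r) * q ^ (2 * i%:Z - 1)) (q ^+ (4 * r))
        + z ^ (2 * i%:Z - 1 - 2 * r%:Z)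
          * qpoch_inf2 (z ^+ (2 * r) * q ^ (2 * i%:Z - 1))
                       (z ^- (2 * r) * q ^ (4 * r%:Z + 1 - 2 * i%:Z))
                       (q ^+ (4 * r)))).
Proof.
have q1 : nrm q < 1 by rewrite -ltcR -nrmE.
case: r hr hi hwd1 hwd2 hdenl => [|[|m]] // _ hi hwd1 _ _.
rewrite !div1r in hdenr *.
have [hA hinf] : qpoch_inf (z ^+ 2 * q ^+ 2) (q ^+ 2) != 0 /\
    qpoch_inf (z ^+ 2)^-1 (q ^+ 2) != 0.
  by move: hdenr; rewrite /qpoch_inf2 mulf_eq0 negb_or => /andP[].
have hzz := one_sub_z2Qz_neq0 hq0 q1 hz hA hinf.
have hout j := outer_factor_neq0 j hq0 hz hwd1.
have h := full_sum hq0 q1 hz hzz hinf hout hi.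
apply: HS_has_sum.
(* [insub] is the partial inverse of the inclusion of nonincreasing tuples; off its domain the
   summand is zero by [chain_path]. *)
have h2 := HS_reindex (h := val : Lambda m.+1 -> _) (h' := insub) valK (insubK _) _ h.
have -> : qpoch_inf2 (- z * q) z^-1 (q ^+ 2)
    / qpoch_inf2 (z ^+ 2 * q ^+ 2) (z ^+ 2)^-1 (q ^+ 2)
  = qpoch_inf (- z * q) (q ^+ 2) / qpoch_inf (z ^+ 2 * q ^+ 2) (q ^+ 2)
    * base_factor q z.
  by rewrite /qpoch_inf2 /base_factor invfM mulrACA.
rewrite -mulrA; apply: eq_HS (h2 _) => [[K sK]|K].
  case/tupleP: K sK => s k sK /=.
  have e := summand_chain s k hq0 hz (proj1 (andP hi)).
  by rewrite size_tuple in e; rewrite theadE -[LHS]e.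
case: insubP => // sK _; apply/eqP; apply: contraNT sK.
by rewrite mulf_eq0 negb_or => /andP[_ /(chain_path hq0)]; rewrite {3}(tuple_eta K).
Qed.
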